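(* There exists on $\left(\Omega=\mathcal C(\mathbb R_+\to\mathbb C),\mathcal F_\infty\right)$ a $\sigma$-finite and positive measure $\mathbf W^{(2)}$ (with infinite total mass) such that, for every $q\in\mathcal I$, $$\mathbf W^{(2)}=\varphi_q(0)\,\exp\left(\tfrac12A^{(q)}_\infty\right)\cdot W_\infty^{(2,q)} .$$ In other terms, the right-hand side does not depend on $q\in\mathcal I$.
   Context: $\Omega=\mathcal C(\mathbb R_+\to\mathbb C)$, $(X_t)$ is the coordinate process, $\mathcal F_t=\sigma(X_s,s\le t)$, $\mathcal F_\infty=\bigvee_t\mathcal F_t$; $W^{(2)}_z$ is the law of two-dimensional (complex) Brownian motion started at $z$, $W^{(2)}=W^{(2)}_0$. $\mathcal I$ is the set of positive Radon measures on $\mathbb C$ admitting a density $q$ with compact support and such that $\int q(x)\,dx>0$; $A_t^{(q)}=\int_0^tq(X_s)\,ds$, $A_\infty^{(q)}=\lim_{t\to\infty}A_t^{(q)}$. The following is a known theorem (Feynman–Kac penalisation in dimension 2), taken for granted for all $q\in\mathcal I$: there is a unique solution $\varphi_q:\mathbb C\to\mathbb R_+$ of $\Delta\varphi=q\,\varphi$ (in the sense of distributions) with $|z|\frac{\partial\varphi}{\partial r}(z)\to\frac1\pi$ as $r=|z|\to\infty$; it is strictly positive, continuous, satisfies $\varphi_q(z)\sim\frac1\pi\log|z|$ as $|z|\to\infty$ and $\varphi_q(z)=\lim_{t\to\infty}\frac{\log t}{2\pi}W_z^{(2)}\left(\exp(-\frac12A^{(q)}_t)\right)$. The process $M_s^{(2,q)}=\frac{\varphi_q(X_s)}{\varphi_q(z)}\exp(-\frac12A_s^{(q)})$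 is a $W_z^{(2)}$-martingale, and $W^{(2,q)}_{z,\infty}$ is the probability on $(\Omega,\mathcal F_\infty)$ with $W^{(2,q)}_{z,\infty}|_{\mathcal F_s}=M_s^{(2,q)}\cdot W_z^{(2)}|_{\mathcal F_s}$ for all $s\ge0$; under it the canonical process is a transient diffusion. $W_\infty^{(2,q)}=W_{0,\infty}^{(2,q)}$. *)

(* Defs.v *)
From HB Require Import structures.
From mathcomp Require Import all_boot all_order all_algebra.
From mathcomp Require Import all_classical all_reals all_analysis.
From mathcomp Require Import measurable_realfun.

Set Implicit Arguments.
Unset Strict Implicit.
Unset Printing Implicit Defensive.
Import Order.TTheory GRing.Theory Num.Theory.
Import numFieldNormedType.Exports.

Local Open Scope classical_set_scope.
Local Open Scope ring_scope.

(* The complex plane as the product of its real and imaginary axes, with the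
   product topology, Borel sigma-algebra and Lebesgue measure. *)
Notation plane R := (R * R)%type.
Notation leb2 := (lebesgue_measure \x lebesgue_measure)%E.

Section plane.
Context {R : realType}.
Implicit Types (z v : plane R) (f : plane R -> R).

(* The modulus; the norm `|z| of the product is the maximum norm. *)
Definition cmod z : R := Num.sqrt (z.1 ^+ 2 + z.2 ^+ 2).

Definition cinfty : set_system (plane R) :=
  filter_from [set: R] (fun r => [set z | r < cmod z]).

Lemma lt_cmod (r : R) : r < cmod (`|r| + 1, 0).
Proof.
rewrite /cmod /= expr0n /= addr0 sqrtr_sqr.
have h : 0 <= `|r| + 1 by rewrite addr_ge0.
rewrite (ger0_norm h); exact: le_lt_trans (ler_norm r) (ltr_pwDr ltr01 (lexx _)).
Qed.

Global Instance cinfty_proper : ProperFilter cinfty.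
Proof.
apply: filter_from_proper; last by move=> r _; exists (`|r| + 1, 0); exact: lt_cmod.
apply: filter_from_filter; first by exists 0.
move=> r s _ _; exists (Num.max r s) => // z /=.
by rewrite gt_max => /andP[].
Qed.

Definition dir_re : plane R := (1, 0).
Definition dir_im : plane R := (0, 1).

Definition laplacian f z : R := 'D_dir_re ('D_dir_re f) z + 'D_dir_im ('D_dir_im f) z.

Fixpoint Ck (k : nat) f : Prop :=
  continuous f /\
  if k is k'.+1 then
    forall v, v = dir_re \/ v = dir_im -> (forall z, derivable f z v) /\ Ck k' ('D_v f)
  else True.

Definition compactly_supported f := compact (closure [set z | f z != 0]).

Definition test_function f := (forall k, Ck k f) /\ compactly_supported f.

Definition radial z : plane R := (cmod z)^-1 *: z.

(* q stands for the measure q(x)dx; as q has compact support, this measure is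
   Radon exactly when q is integrable. *)
Definition classI (q : plane R -> R) : Prop :=
  [/\ measurable_fun [set: plane R] q, forall z, 0 <= q z,
      compactly_supported q, leb2.-integrable [set: plane R] (EFin \o q) &
      (0 < \int[leb2]_z (q z)%:E)%E].

Definition locally_integrable f := forall K : set (plane R), compact K ->
  leb2.-integrable K (EFin \o f).

(* Delta phi = q phi as distributions, which requires phi and q phi to be
   locally integrable. *)
Definition weak_solution (q phi : plane R -> R) : Prop :=
  [/\ locally_integrable phi, locally_integrable (q \* phi) &
    forall f, test_function f ->
      (\int[leb2]_z (phi z * laplacian f z)%:E =
       \int[leb2]_z (q z * phi z * f z)%:E)%E].

Definition radial_condition (phi : plane R -> R) : Prop :=
  (\forall z \near cinfty, derivable phi z (radial z)) /\
  cmod z * 'D_(radial z) phi z @[z --> cinfty] --> pi^-1.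

End plane.

Definition halfline (R : realType) : set R := [set t | 0 <= t].
Arguments halfline : clear implicits.

(* set_type carries the subspace topology. *)
Definition path (R : realType) : Type :=
  continuousType (set_type (halfline R)) (plane R).

HB.instance Definition _ (R : realType) := Choice.on (path R).
HB.instance Definition _ (R : realType) :=
  isPointed.Build (path R) (cst (0, 0) : continuousType _ _).

Section canonical_process.
Context {R : realType}.

Lemma max0_halfline (t : R) : Num.max 0 t \in halfline R.
Proof. by apply/mem_set; rewrite /halfline /= le_max lexx. Qed.

(* Times are real numbers; negative times are sent to 0 and never matter. *)
Definition coord (t : R) (w : path R) : plane R :=
  w (exist _ (Num.max 0 t) (max0_halfline t)).

Definition filt (t : R) : set (set (path R)) :=
  <<s \bigcup_(s in [set s | 0 <= s <= t])
        preimage_set_system [set: path R] (coord s) measurable >>.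

End canonical_process.

(* Its measurable sets form F_infty. *)
Definition Omega (R : realType) : Type :=
  g_sigma_algebraType (\bigcup_(t in halfline R) filt t).

HB.instance Definition _ (R : realType) := Measurable.on (Omega R).

Section penalisation.
Context {R : realType}.
Local Open Scope ereal_scope.

(* X_t - X_s is independent of F_s, with law N(0, (t - s) Id);
   the second argument of normal_prob is the standard deviation. *)
Definition brownian_law (z : plane R) (W : probability (Omega R) R) : Prop :=
  W [set w | coord 0 w = z] = 1 /\
  forall s t : R, (0 <= s < t)%R ->
    forall (A : set (path R)) (B : set (plane R)), filt s A -> measurable B ->
      W (A `&` [set w | B (coord t w - coord s w)%R]) =
      W A * (normal_prob 0 (Num.sqrt (t - s)) \x
             normal_prob 0 (Num.sqrt (t - s))) B.

Definition additive_functional (q : plane R -> R) (t : R) (w : path R) : \bar R :=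
  \int[lebesgue_measure]_(s in `[0%R, t]) (q (coord s w))%:E.

Definition additive_functional_infty (q : plane R -> R) (w : path R) : \bar R :=
  lim (additive_functional q t w @[t --> +oo%R]).

Definition martingale (W : probability (Omega R) R) (M : R -> path R -> \bar R) :=
  [/\ forall (t : R) (B : set (\bar R)), (0 <= t)%R ->
       measurable B -> filt t (M t @^-1` B),
      forall t : R, (0 <= t)%R -> W.-integrable [set: Omega R] (M t) &
      forall (s t : R) A, (0 <= s <= t)%R -> filt s A ->
        \int[W]_(w in A) M t w = \int[W]_(w in A) M s w].

(* Extended-real valued because A_s may be infinite; expeR -oo = 0. *)
Definition penalisation_density (q phi : plane R -> R) (z : plane R)
    (s : R) (w : path R) : \bar R :=
  (phi (coord s w) / phi z)%:E * expeR (- (2^-1%:E * additive_functional q s w)).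

Definition phi_solution (q phi : plane R -> R) : Prop :=
  [/\ forall z, (0 <= phi z)%R, weak_solution q phi & radial_condition phi].

Definition phi_properties (W : plane R -> probability (Omega R) R)
    (q phi : plane R -> R) : Prop :=
  [/\ forall z, (0 < phi z)%R, continuous phi,
      (phi z / ln (cmod z))%R @[z --> cinfty] --> (pi^-1)%R,
      forall z, (ln t / (2 * pi))%:E *
          \int[W z]_w expeR (- (2^-1%:E * additive_functional q t w))
        @[t --> +oo%R] --> (phi z)%:E &
      forall z, martingale (W z) (penalisation_density q phi z)].

Definition penalised_law (Wz : probability (Omega R) R) (q phi : plane R -> R)
    (z : plane R) (P : probability (Omega R) R) : Prop :=
  forall (s : R) A, (0 <= s)%R -> filt s A ->
    P A = \int[Wz]_(w in A) penalisation_density q phi z s w.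

Definition transient (P : probability (Omega R) R) : Prop :=
  {ae P, forall w, cmod (coord t w) @[t --> +oo%R] --> +oo%R}.

End penalisation.

(* Main.v *)
From HB Require Import structures.
Require Import Defs.
From mathcomp Require Import all_boot all_order all_algebra.
From mathcomp Require Import all_classical all_reals all_analysis.
From mathcomp Require Import measurable_realfun.
From mathcomp Require Import ring lra.
Import Order.TTheory GRing.Theory Num.Theory.
Import numFieldNormedType.Exports.
Import Defs.
Local Open Scope classical_set_scope.
Local Open Scope ring_scope.

(** Fix a potential q with its function phi and penalised law P, and let A_t be its
    additive functional. Up to time t the law P has density
    phi(X_t) exp(- A_t / 2) / phi(0) with respect to the Wiener measure W_0, so the
    weighted law phi(0) exp(A_t / 2) P is there phi(X_t) W_0, provided that A_t is
    finite. As phi is equivalent to log / pi at infinity for every q, and as paths are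
    transient under P, this should not depend on q in the limit.

    To make the limit rigorous, take two potentials, with functions phi1, phi2, laws
    P1, P2 and functionals A1, A2. For an event G known at a finite time and for t
    large, both
    phi1(0) E1[G (phi2/phi1)(X_t) exp(- A2_t / 2)] and phi2(0) E2[G exp(- A1_t / 2)]
    are equal to the Wiener expectation of G phi2(X_t) exp(- (A1_t + A2_t) / 2)
    ([level_identity]). The quotient phi2/phi1 is bounded and tends to 1 along
    transient paths, so dominated convergence ([level_limit]) gives
    phi1(0) E1[G exp(- A2 / 2)] = phi2(0) E2[G exp(- A1 / 2)] with the total
    functionals A1 and A2. These are finite measures which agree on a generating
    pi-system, hence everywhere; integrating exp((A1 + A2) / 2) against them yields the
    identity of the weighted laws ([weight_identity]), because A2 is finite almost
    surely under P1, and A1 under P2.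

    That finiteness ([penalised_infty_lty]) reduces, by transience and by compactness
    of the support of q, to the finiteness of A_t under W_0. The potential q is only
    integrable, so this needs an argument ([potential_bound]). The martingale property
    from every starting point z gives
    phi(z) = E_z[phi(X_h) exp(- A_h / 2)], so E_z[phi(X_h)] - phi(z) is at least
    c E_z[1 - exp(- A_h / 2)], where c > 0 is a lower bound of phi. Truncating q at
    level m and taking h <= 1 / m, this is at least c / 4 times the expectation of the
    truncated functional ([drift]). Both sides involve only Gaussian averages, so the
    semigroup property lets the increments add up: E_0[A_t] is at most
    (4 / c) E_0[phi(X_t)], which is finite since phi grows like a logarithm.

    The total mass is at least E_0[phi(X_t)] for all t ([weight_mass_ge]), and this is
    unbounded because phi tends to infinity and X_t spreads out
    ([expectation_large]). *)

(** * Measurability and integration *)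

(** Continuity in the real variable makes f the pointwise limit of the functions
    obtained by rounding that variable down to a grid, and these are measurable
    because they only involve countably many sections of f. *)
Lemma caratheodory_measurable d (T : measurableType d) (R : realType)
    (f : R -> T -> R) :
  (forall x, continuous (f^~ x)) -> (forall s, measurable_fun setT (f s)) ->
  measurable_fun setT (fun p : R * T => f p.1 p.2).
Proof.
move=> cf mf.
(* grid n rounds down to the multiples of 1 / (n + 1). *)
pose grid n (s : R) : R := (Num.floor (n.+1%:R * s))%:~R / n.+1%:R.
have gridE n s : `|grid n s - s| <= n.+1%:R^-1.
  have n0 : (0 : R) < n.+1%:R by [].
  rewrite /grid -[X in _ - X](mulKf (lt0r_neq0 n0)) [_^-1 * _]mulrC -mulrBl.
  rewrite normrM normfV (gtr0_norm n0) ler_piMl ?invr_ge0 ?ltW//.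
  have /andP[h1 h2] := floor_itv (n.+1%:R * s).
  rewrite intrD in h2.
  rewrite distrC ger0_norm ?subr_ge0//; move: h2; rewrite mulr1z; lra.
apply: (@measurable_fun_cvg _ _ _ _ (fun n p => f (grid n p.1) p.2)).
- move=> n _ B mB; rewrite setTI.
  rewrite (_ : _ @^-1` _ = \bigcup_(k in [set: int])
      ((fun s : R => Num.floor (n.+1%:R * s)) @^-1` [set k] `*`
       (f (k%:~R / n.+1%:R)) @^-1` B)); last first.
    apply/seteqP; split=> [[s x]/= Bx|[s x] /= [k _ []/= <-//]].
    by exists (Num.floor (n.+1%:R * s)).
  apply: countable_bigcupT_measurable => //= k.
  apply: measurableX; last by rewrite -[X in measurable X]setTI; exact: mf.
  rewrite (_ : _ @^-1` _ = `[k%:~R / n.+1%:R, (k + 1)%:~R / n.+1%:R[%classic); first exact: measurable_itv.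
  apply/seteqP; split=> s /=; rewrite in_itv/= ler_pdivrMr// ltr_pdivlMr// ![s * _]mulrC.
    by move=> <-; exact: floor_itv.
  by move/floor_def.
- move=> [s x] _ /=.
  apply: (cvg_comp (grid ^~ s) (f ^~ x) _ (cf x s)).
  apply/cvgrPdist_le => e e0; near=> n; rewrite distrC.
  apply: le_trans (gridE n s) _; apply: ltW.
  by near: n; exact: (near_infty_natSinv_lt (PosNum e0)).
Unshelve. all: by end_near. Qed.

Lemma ae_impl d (T : measurableType d) (R : realType) (mu : {measure set T -> \bar R})
    (P Q : T -> Prop) :
  (forall x, P x -> Q x) -> {ae mu, forall x, P x} -> {ae mu, forall x, Q x}.
Proof. by move=> PQ; apply: filterS. Qed.

Lemma ae_all d (T : measurableType d) (R : realType) (mu : {measure set T -> \bar R})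
    (P : nat -> T -> Prop) :
  (forall n, {ae mu, forall x, P n x}) -> {ae mu, forall x, forall n, P n x}.
Proof. by move=> h; apply/ae_foralln. Qed.

Lemma ae_and d (T : measurableType d) (R : realType) (mu : {measure set T -> \bar R})
    (P Q : T -> Prop) :
  {ae mu, forall x, P x} -> {ae mu, forall x, Q x} -> {ae mu, forall x, P x /\ Q x}.
Proof. exact: filterI. Qed.

Section density.
Import HBNNSimple.
Local Open Scope ereal_scope.

(** Both sides are limits along simple functions increasing to f, for which the
    equality is the hypothesis on nu. Finiteness of g lets g be multiplied into the
    limit. *)
Lemma integral_density d (T : measurableType d) (R : realType)
    (mu nu : {measure set T -> \bar R}) (g : T -> \bar R) :
  measurable_fun setT g -> (forall x, 0 <= g x) -> (forall x, g x \is a fin_num) ->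
  (forall A, measurable A -> nu A = \int[mu]_(x in A) g x) ->
  forall f, measurable_fun setT f -> (forall x, 0 <= f x) ->
  \int[nu]_x f x = \int[mu]_x (f x * g x).
Proof.
move=> mg g0 gfin nuE f mf f0.
pose h := nnsfun_approx measurableT mf.
have hf x : (EFin \o h n) x @[n --> \oo] --> f x by exact: cvg_nnsfun_approx.
have ndh x : {homo (fun n => h n x) : a b / (a <= b)%N >-> (a <= b)%R}.
  by move=> a b ab; exact/lefP/nd_nnsfun_approx.
have -> : \int[nu]_x f x = limn (fun n => \int[nu]_x (h n x)%:E).
  rewrite -monotone_convergence//.
  - by apply: eq_integral => x _; apply/esym/cvg_lim => //; exact: hf.
  - by move=> n; exact/measurable_EFinP/measurable_funP.
  - by move=> n x _; rewrite lee_fin.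
  - by move=> x _ a b ab; rewrite lee_fin; exact: ndh.
have -> : \int[mu]_x (f x * g x) = limn (fun n => \int[mu]_x ((h n x)%:E * g x)).
  rewrite -monotone_convergence//.
  - apply: eq_integral => x _; apply/esym/cvg_lim => //.
    by apply: cvgeZr => //; exact: hf.
  - by move=> n; apply: emeasurable_funM => //; exact/measurable_EFinP/measurable_funP.
  - by move=> n x _; rewrite mule_ge0 ?lee_fin.
  - by move=> x _ a b ab; rewrite lee_wpmul2r// lee_fin; exact: ndh.
apply: congr_lim; apply/funext => n.
have mh y : measurable (h n @^-1` [set y]) by exact: measurable_sfunP.
transitivity (\sum_(y \in range (h n)) y%:E * nu (h n @^-1` [set y])).
  by rewrite integralT_nnsfun sintegralE.
transitivity (\sum_(y \in range (h n)) \int[mu]_x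
    (y%:E * (\1_(h n @^-1` [set y]) x)%:E * g x)).
  apply: eq_fsbigr => y; rewrite inE => -[x0 _ <-].
  under [RHS]eq_integral do rewrite -muleA.
  rewrite ge0_integralZl ?lee_fin//; last 2 first.
  - by apply: emeasurable_funM => //; apply/measurable_EFinP; exact: measurable_indic.
  - by move=> x _; rewrite mule_ge0 ?lee_fin.
  congr (_ * _); rewrite nuE// integral_mkcond; apply: eq_integral => x _.
  by rewrite patchE indicE; case: ifPn => _; rewrite ?mul1e ?mul0e.
rewrite -ge0_integral_fsum//.
- apply: eq_integral => x _.
  rewrite -ge0_mule_fsuml//; last by move=> y; exact: nnfun_muleindic_ge0.
  congr (_ * _); rewrite fimfunE -fsumEFin//.
- move=> y; apply: emeasurable_funM => //; apply: emeasurable_funM => //.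
  by apply/measurable_EFinP; exact: measurable_indic.
- by move=> y x _; rewrite mule_ge0//; exact: nnfun_muleindic_ge0.
Qed.
End density.

Lemma lebesgue_measure_shift (R : realType) (a : R) (A : set R) : measurable A ->
  pushforward lebesgue_measure (fun x : R => (a + x : measurableTypeR R)) A =
  lebesgue_measure A.
Proof.
have ma : measurable_fun setT (fun x : R => a + x) by exact: measurable_funD.
move=> mA; apply/esym/lebesgue_measure_unique => //=.
move=> _ [[x y]] _ <-.
rewrite /pushforward (_ : _ @^-1` _ = `]x - a, y - a]%classic); last first.
  by apply/seteqP; split=> z /=; rewrite !in_itv/= ltrBlDl lerBrDl.
rewrite !lebesgue_measure_itv/= !lte_fin ltrD2r; case: ifP => // _.
by rewrite -!EFinD; congr EFin; ring.
Qed.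

Lemma ge0_integral_shift (R : realType) (a b c : R) (f : R -> \bar R) :
  measurable_fun setT f -> (forall x, 0 <= f x)%E ->
  (\int[lebesgue_measure]_(x in `[(a + b)%R, (a + c)%R]) f x =
   \int[lebesgue_measure]_(x in `[b, c]) f (a + x)%R)%E.
Proof.
move=> mf f0.
have ma : measurable_fun setT (fun x : R => (a + x : measurableTypeR R)).
  exact: measurable_funD.
transitivity (\int[pushforward lebesgue_measure (fun x : R => (a + x : measurableTypeR R)%R)]_(x in `[(a + b)%R, (a + c)%R]) f x)%E.
  by apply: eq_measure_integral => A mA _; exact/esym/lebesgue_measure_shift.
rewrite ge0_integral_pushforward//; last exact: measurable_funTS.
rewrite (_ : _ @^-1` _ = `[b, c]%classic)//.
by apply/seteqP; split=> z /=; rewrite !in_itv/= !lerD2l.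
Qed.

(** Freezing X leaves Y with law nu, by independence: this is Fubini for the
    product law of (X, Y). *)
Lemma integral_independent d d1 d2 (T : measurableType d) (U : measurableType d1)
    (V : measurableType d2) (R : realType) (P : probability T R)
    (nu : probability V R) (X : T -> U) (Y : T -> V) :
  measurable_fun setT X -> measurable_fun setT Y ->
  (forall A B, measurable A -> measurable B ->
    P (X @^-1` A `&` Y @^-1` B) = P (X @^-1` A) * nu B)%E ->
  forall f : U * V -> \bar R, measurable_fun setT f -> (forall p, 0 <= f p)%E ->
  (\int[P]_w f (X w, Y w) = \int[P]_w \int[nu]_y f (X w, y))%E.
Proof.
move=> mX mY XY f mf f0.
pose X' : {mfun T >-> U} := HB.pack X (isMeasurableFun.Build _ _ _ _ _ mX).
have mJ : measurable_fun setT (fun w => (X w, Y w)) by exact: measurable_fun_pair.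
transitivity (\int[pushforward P (fun w => (X w, Y w))]_p f p)%E.
  by rewrite ge0_integral_pushforward.
transitivity (\int[(distribution P X' \x nu)%E]_p f p)%E.
  apply: eq_measure_integral => A mA _; apply/esym.
  apply: product_measure_unique => // B C mB mC; exact: XY.
rewrite (fubini_tonelli1 (m1 := distribution P X') (m2 := nu) f)//.
rewrite ge0_integral_pushforward//.
- exact: (measurable_fun_fubini_tonelli_F (m2 := nu) f).
- by move=> y _; exact: integral_ge0.
Qed.

(** Indicators of D turn integrals over D into integrals over the whole line, to
    which Tonelli applies. *)
Section tonelli_restricted.
Local Open Scope ereal_scope.
Context {R : realType} d (T : measurableType d).
Variables (D : set R) (mD : measurable D) (f : R * T -> \bar R).
Hypotheses (mf : measurable_fun setT f) (f0 : forall p, 0 <= f p).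

Let g (p : R * T) := ((\1_D p.1 : R)%:E * f p).

Let mg : measurable_fun setT g.
Proof.
apply: emeasurable_funM => //; apply/measurable_EFinP.
apply: (@measurableT_comp _ _ _ _ _ _ (\1_D : R -> R)) => //.
Qed.

Let g0 p : 0 <= g p.
Proof. by rewrite mule_ge0// lee_fin. Qed.

Let gE x : \int[lebesgue_measure]_(s in D) f (s, x) = \int[lebesgue_measure]_s g (s, x).
Proof.
rewrite integral_mkcond; apply: eq_integral => s _.
by rewrite patchE /g/= indicE; case: ifPn => _; rewrite ?mul1e ?mul0e.
Qed.

Lemma measurable_integral_restricted :
  measurable_fun setT (fun x => \int[lebesgue_measure]_(s in D) f (s, x)).
Proof.
under eq_fun do rewrite gE.
exact: (measurable_fun_fubini_tonelli_G (m1 := lebesgue_measure) g).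
Qed.

Lemma tonelli_restricted (m : {sigma_finite_measure set T -> \bar R}) :
  \int[m]_x \int[lebesgue_measure]_(s in D) f (s, x) =
  \int[lebesgue_measure]_(s in D) \int[m]_x f (s, x).
Proof.
under eq_integral do rewrite gE.
rewrite -(fubini_tonelli (m1 := lebesgue_measure) (m2 := m) g)//.
rewrite [RHS]integral_mkcond; apply: eq_integral => s _; rewrite patchE.
rewrite /fubini_F /g/=; case: ifPn => sD; under eq_integral do rewrite indicE ?sD.
  by under eq_integral do rewrite mul1e.
by rewrite integral0_eq// => x _; rewrite (negbTE sD) mul0e.
Qed.
End tonelli_restricted.

(** The measures compared in the end are all given by densities; carrying the
    hypotheses on the density as arguments makes the measure structure
    inferable. *)
Definition density_measure d (T : measurableType d) (R : realType)
    (mu : {measure set T -> \bar R}) (f : T -> \bar R)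
    (mf : measurable_fun setT f) (f0 : forall x, (0 <= f x)%E) (A : set T) : \bar R :=
  (\int[mu]_(x in A) f x)%E.

Section density_measure.
Context d (T : measurableType d) (R : realType) (mu : {measure set T -> \bar R}).
Variables (f : T -> \bar R) (mf : measurable_fun setT f) (f0 : forall x, (0 <= f x)%E).
Let m := density_measure _ T R mu f mf f0.
Let m0 : m set0 = 0%E. Proof. exact: integral_set0. Qed.
Let m_ge0 A : (0 <= m A)%E. Proof. exact: integral_ge0. Qed.
Let m_sigma_additive : semi_sigma_additive m.
Proof. exact: semi_sigma_additive_nng_induced. Qed.
HB.instance Definition _ := isMeasure.Build _ _ _ (density_measure _ T R mu f mf f0)
  m0 m_ge0 m_sigma_additive.
End density_measure.
Arguments density_measure {d T R} mu {f}.

(** * The extended exponential *)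

Lemma measurable_expeR (R : realType) : measurable_fun setT (@expeR R).
Proof.
move=> _; apply: (measurability _ (ErealGenOInfty.measurableE R)) => //.
move=> _ [_ [r ->] <-]; rewrite setTI.
have [r0|r0] := ltP r 0.
  rewrite (_ : _ @^-1` _ = setT); first exact: measurableT.
  by apply/seteqP; split=> // x _; rewrite /= in_itv/= andbT (lt_le_trans _ (expeR_ge0 x)).
have [y yr] : exists y : \bar R, expeR y = r%:E by apply: expeR_total; rewrite lee_fin.
rewrite (_ : _ @^-1` _ = `]y, +oo[%classic); first exact: emeasurable_itv.
by apply/seteqP; split=> x /=; rewrite !in_itv/= !andbT -yr lte_expeR.
Qed.

Lemma expeR_cvg (R : realType) (v : nat -> \bar R) (l : \bar R) :
  (l < +oo)%E -> v n @[n --> \oo] --> l -> expeR (v n) @[n --> \oo] --> expeR l.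
Proof.
case: l => [r _|//|_] vl.
- have /fine_cvgP[vfin vf] := vl.
  apply/fine_cvgP; split.
    near=> n; have : v n \is a fin_num by near: n.
    by case: (v n).
  apply: (@cvg_trans _ (expR (fine (v n)) @[n --> \oo])).
    apply: near_eq_cvg; near=> n => /=.
    have : v n \is a fin_num by near: n.
    by case: (v n).
  by apply: continuous_cvg => //; exact: continuous_expR.
- apply/fine_cvgP; split.
    near=> n; have : (v n < 0)%E by near: n; move/cvgeNyPlt : vl; exact.
    by case: (v n).
  apply/cvgrPdist_lt => e e0; near=> n.
  have : (v n < (ln e)%:E)%E by near: n; move/cvgeNyPlt : vl; exact.
  rewrite sub0r normrN /=.
  case: (v n) => [r||]//=; last by rewrite normr0.
  by rewrite lte_fin => rl; rewrite ger0_norm ?expR_ge0// -(@lnK _ e) ?posrE// ltr_expR.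
Unshelve. all: by end_near. Qed.

Lemma discount_cvg (R : realType) (u : nat -> \bar R) (l : \bar R) :
  (0 <= l)%E -> u n @[n --> \oo] --> l ->
  expeR (- (2^-1%:E * u n))%E @[n --> \oo] --> expeR (- (2^-1%:E * l))%E.
Proof.
move=> l0 ul; apply: expeR_cvg.
  by rewrite (le_lt_trans _ (ltry 0))// oppe_le0 mule_ge0// lee_fin invr_ge0.
by apply: cvgeN; exact: cvgeZl.
Qed.

(** Over a time so short that the additive functional b of a truncated potential
    stays below 1, discounting a value p >= c by a larger functional a costs at
    least a fixed multiple of b, since 1 - exp(- b / 2) >= b / 4 on [0, 1]. An
    infinite a is harmless. *)
Lemma discount_gap (R : realType) (a b : \bar R) (p c : R) :
  (0 <= b)%E -> (b <= a)%E -> (b <= 1)%E -> 0 <= c -> c <= p ->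
  (p%:E * expeR (- (2^-1%:E * a)) + (c / 4)%:E * b <= p%:E)%E.
Proof.
case: b => [b||]//; rewrite lee_fin => b0 ba; rewrite lee_fin => b1 c0 cp.
have p0 : 0 <= p by exact: le_trans cp.
have cb : c / 4 * b <= c / 4 by rewrite ler_piMr// divr_ge0.
case: a ba => [a||]//; rewrite ?lee_fin => ba; last first.
  rewrite gt0_muley ?lte_fin ?invr_gt0//= mule0 add0e -EFinM lee_fin.
  by apply: le_trans cb _; lra.
have eb : expR (- (2^-1 * a)) <= 1 - b / 4.
  apply: (@le_trans _ _ (expR (- (b / 2)))); first by rewrite ler_expR; lra.
  rewrite expRN -[leRHS]mulr1 -[X in _ <= _ * X](@mulfV _ (expR (b / 2))) ?gt_eqF ?expR_gt0//.
  rewrite mulrA ler_peMl// ?invr_ge0 ?expR_ge0//.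
  apply: (@le_trans _ _ ((1 - b / 4) * (1 + b / 2))); first by nra.
  by apply: ler_wpM2l; [lra|exact: expR_ge1Dx].
have : p * expR (- (2^-1 * a)) <= p * (1 - b / 4) by apply: ler_wpM2l.
have : c * b <= p * b by exact: ler_wpM2r.
lra.
Qed.

(** * Functions on the plane *)

Lemma continuous_plane_measurable (R : realType) (f : plane R -> R) :
  continuous f -> measurable_fun setT f.
Proof.
move=> cf.
have fst_c (y x : R) : {for x, continuous (fun x => f (x, y))}.
  apply: (@continuous_comp _ _ _ (fun x => (x, y)) f); last exact: cf.
  exact: (cvg_pair cvg_id (cvg_cst _)).
have snd_c (x y : R) : {for y, continuous (fun y => f (x, y))}.
  apply: (@continuous_comp _ _ _ (fun y => (x, y)) f); last exact: cf.
  exact: (cvg_pair (cvg_cst _) cvg_id).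
rewrite (_ : f = (fun p => f (p.1, p.2))); last by apply/funext => -[].
apply: (@caratheodory_measurable _ _ _ (fun x y => f (x, y))) => //.
by move=> s; apply: continuous_measurable_fun => y; exact: snd_c.
Qed.

Lemma plane_bounded (R : realType) (f : plane R -> R) (r M : R) :
  continuous f -> (forall z, r < cmod z -> f z <= M) ->
  exists K, forall z, f z <= K.
Proof.
move=> cf fM.
pose s := Num.max 0 r.
have s0 : 0 <= s by rewrite le_max lexx.
pose B : set (plane R) := `[- s, s]%classic `*` `[- s, s]%classic.
have cB : compact B by apply: compact_setX; exact: segment_compact.
have [|c _ fc] := @compact_EVT_max _ _ f B _ cB (continuous_subspaceT cf).
  by exists (0, 0); split; rewrite /= in_itv/= oppr_le0 s0.
exists (Num.max M (f c)) => z; rewrite le_max.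
have [rz|zr] := ltP r (cmod z); first by rewrite fM.
apply/orP; right; apply: fc; apply: mem_set.
have zs : cmod z <= s by rewrite (le_trans zr)// le_max lexx orbT.
have abs_cmod (x y : R) : `|x| <= Num.sqrt (x ^+ 2 + y ^+ 2).
  by rewrite -sqrtr_sqr ler_wsqrtr// lerDl sqr_ge0.
split; rewrite /= in_itv/= -ler_norml; apply: le_trans zs; first exact: abs_cmod.
by rewrite /cmod addrC; exact: abs_cmod.
Qed.

Lemma compactly_supported_bound (R : realType) (q : plane R -> R) : compactly_supported q ->
  exists r : R, forall z, (r < cmod z)%R -> q z = 0%R.
Proof.
move=> cq; pose f (z : plane R) := (z.1 ^+ 2 + z.2 ^+ 2)%R.
have cf : continuous f.
  move=> z; apply: cvgD.
    apply: (@continuous_comp _ _ _ fst (fun x : R => x ^+ 2)%R); first exact: cvg_fst.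
    exact: sqr_continuous.
  apply: (@continuous_comp _ _ _ snd (fun x : R => x ^+ 2)%R); first exact: cvg_snd.
  exact: sqr_continuous.
have [S0|S0] := eqVneq (closure [set z | q z != 0%R]) set0.
  exists 0%R => z _; apply/eqP/negPn/negP => qz.
  by have : closure [set z | q z != 0%R] z by [exact: subset_closure]; rewrite S0.
have [c _ fc] := compact_EVT_max (proj1 (set0P _) S0) cq (continuous_subspaceT cf).
exists (Num.sqrt (f c)) => z; apply: contraTeq => qz; rewrite -leNgt.
by rewrite ler_wsqrtr//; apply/fc/mem_set; exact: subset_closure.
Qed.

(** * Paths and additive functionals *)

Section paths.
Context {R : realType}.
Implicit Types (q : plane R -> R) (s t : R) (w : path R).

Lemma coord_continuous w : continuous (coord ^~ w).
Proof.
move=> t; pose i t : set_type (halfline R) := exist _ (Num.max 0 t) (max0_halfline t).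
apply: (@continuous_comp _ _ _ i w); last exact: cts_fun.
apply: (@continuous_comp_initial _ _ _ (@set_val _ (halfline R)) i) => {}t.
by move=> x; apply: continuous_max; [exact: cvg_cst|exact: cvg_id].
Qed.

Lemma filt_coord s t (B : set (plane R)) :
  0 <= s <= t -> measurable B -> filt t (coord s @^-1` B).
Proof.
move=> st mB; apply: sub_sigma_algebra; exists s => //.
by exists B => //; rewrite setTI.
Qed.

Lemma filt_measurable t (A : set (Omega R)) : 0 <= t -> filt t A -> measurable A.
Proof. by move=> t0 At; apply: sub_sigma_algebra; exists t. Qed.

Lemma filt_mono s t (A : set (path R)) : s <= t -> filt s A -> filt t A.
Proof.
move=> st; apply: sub_sigma_algebra2 => B [u /= /andP[u0 us] Bu].
by exists u => //=; rewrite u0 (le_trans us).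
Qed.

Lemma measurable_coord t : measurable_fun [set: Omega R] (coord t).
Proof.
move=> _ B mB; rewrite setTI.
have -> : coord t @^-1` B = coord (Num.max 0 t) @^-1` B.
  apply/funext => w; rewrite /preimage/= /coord; congr (B (w _)).
  by apply: val_inj => /=; rewrite maxA maxxx.
have t0 : 0 <= Num.max 0 t by rewrite le_max lexx.
by apply: (filt_measurable _ _ t0); apply: filt_coord; rewrite ?t0 ?lexx.
Qed.

(** Joint measurability in time and path is what path continuity is used for: it
    allows Tonelli between time and the path space. *)
Lemma measurable_coord_pair :
  measurable_fun [set: R * Omega R] (fun p => coord p.1 p.2).
Proof.
apply/measurable_fun_pairP; split.
- apply: (@caratheodory_measurable _ (Omega R) R (fun t w => (coord t w).1)).
    by move=> w t; apply: (cvg_comp _ _ (@coord_continuous w t)); exact: cvg_fst.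
  by move=> t; exact: (measurableT_comp measurable_fst (measurable_coord t)).
- apply: (@caratheodory_measurable _ (Omega R) R (fun t w => (coord t w).2)).
    by move=> w t; apply: (cvg_comp _ _ (@coord_continuous w t)); exact: cvg_snd.
  by move=> t; exact: (measurableT_comp measurable_snd (measurable_coord t)).
Qed.

Lemma filtT t : filt t setT.
Proof.
have [f0 fC _] := smallest_sigma_algebra [set: path R] (\bigcup_(s in [set s | 0 <= s <= t])
        preimage_set_system [set: path R] (coord s) measurable).
by rewrite -(setD0 setT); exact: fC.
Qed.

End paths.

Section additive_functional.
Local Open Scope ereal_scope.
Context {R : realType} (q : plane R -> R).
Hypotheses (mq : measurable_fun setT q) (q0 : forall z, (0 <= q z)%R).

Lemma measurable_along_paths :
  measurable_fun [set: R * Omega R] (fun p => (q (coord p.1 p.2))%:E).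
Proof. by apply/measurable_EFinP; exact: (measurableT_comp mq measurable_coord_pair). Qed.

Lemma measurable_along_path (w : path R) :
  measurable_fun [set: R] (fun s => (q (coord s w))%:E).
Proof.
exact: (measurableT_comp measurable_along_paths (@pair2_measurable _ _ R (Omega R) w)).
Qed.

Lemma additive_functional_ge0 t w : 0 <= additive_functional q t w.
Proof. by apply: integral_ge0 => s _; rewrite lee_fin. Qed.

Lemma additive_functional_nd w : {homo additive_functional q ^~ w : s t / (s <= t)%R >-> s <= t}.
Proof.
move=> s t st; apply: ge0_subset_integral => //.
- exact: measurable_funTS (measurable_along_path w).
- by move=> u _; rewrite lee_fin.
- by apply: subset_itvl; rewrite bnd_simp.
Qed.

Lemma additive_functional0 w : additive_functional q 0 w = 0.
Proof. by rewrite /additive_functional set_itv1 integral_set1. Qed.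

Lemma additive_functional_inftyE w :
  additive_functional_infty q w = ereal_sup (range (additive_functional q ^~ w)).
Proof. by apply/cvg_lim => //; exact: nondecreasing_cvge (additive_functional_nd w). Qed.

Lemma additive_functional_le_infty t w :
  additive_functional q t w <= additive_functional_infty q w.
Proof. by rewrite additive_functional_inftyE; apply: ereal_sup_ubound; exists t. Qed.

Lemma additive_functional_infty_ge0 w : 0 <= additive_functional_infty q w.
Proof. exact: le_trans (additive_functional_ge0 0 w) (additive_functional_le_infty _ _). Qed.

Lemma additive_functional_cvg w :
  additive_functional q n%:R w @[n --> \oo] --> additive_functional_infty q w.
Proof.
rewrite additive_functional_inftyE.
apply: (cvg_comp _ _ (@cvgr_idn R) (nondecreasing_cvge (additive_functional_nd w))).
Qed.

Lemma measurable_additive_functional t :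
  measurable_fun [set: Omega R] (additive_functional q t).
Proof.
apply: (@measurable_integral_restricted _ _ (Omega R) `[0%R, t]%classic _
  (fun p => (q (coord p.1 p.2))%:E)) => //.
- exact: measurable_along_paths.
- by move=> p; rewrite lee_fin.
Qed.

Lemma measurable_additive_functional_infty :
  measurable_fun [set: Omega R] (additive_functional_infty q).
Proof.
apply: (@emeasurable_fun_cvg _ (Omega R) R setT (fun n => additive_functional q n%:R)).
- by move=> n; exact: measurable_additive_functional.
- by move=> w _; exact: additive_functional_cvg.
Qed.

Definition discount t (w : path R) := expeR (- (2^-1%:E * additive_functional q t w)).

Definition discount_infty (w : path R) :=
  expeR (- (2^-1%:E * additive_functional_infty q w)).

End additive_functional.

(** * One-time laws of Brownian motion *)

Section brownian.
Context {R : realType} (W : plane R -> probability (Omega R) R).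
Hypothesis brownian_W : forall z : plane R, brownian_law z (W z).
Local Open Scope ereal_scope.

Let WT z : W z [set: Omega R] = 1.
Proof. exact: probability_setT. Qed.

Lemma measurable_plane_set1 (z : plane R) : measurable [set z].
Proof.
case: z => x y; rewrite (_ : [set _] = [set x] `*` [set y]); first exact: measurableX.
by apply/seteqP; split=> [_ ->//|[a b] [/= -> ->]].
Qed.

Lemma brownian_start z : {ae W z, forall w, coord 0 w = z}.
Proof.
have mz : measurable ([set w | coord 0 w = z] : set (Omega R)).
  rewrite -[X in measurable X]setTI.
  exact: (measurable_coord 0 measurableT [set z] (measurable_plane_set1 z)).
exists (~` [set w | coord 0 w = z]); split => //; first exact: measurableC.
by rewrite probability_setC// (brownian_W z).1 subee.
Qed.

(** The Gaussian semigroup, realised by the increments of the process started at 0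
    so that its joint measurability in (z, u) comes from that of the process. *)
Definition transition (f : plane R -> R) (z : plane R) (u : R) : \bar R :=
  \int[W 0%R]_w (f (z + (coord u w - coord 0 w))%R)%:E.

Lemma measurable_increment s t :
  measurable_fun [set: Omega R] (fun w => coord t w - coord s w)%R.
Proof.
have m1 u : measurable_fun [set: Omega R] (fun w => (coord u w).1).
  exact: (measurableT_comp measurable_fst (measurable_coord u)).
have m2 u : measurable_fun [set: Omega R] (fun w => (coord u w).2).
  exact: (measurableT_comp measurable_snd (measurable_coord u)).
by apply/measurable_fun_pairP; split; exact: measurable_funB.
Qed.

Lemma measurable_plane_add : measurable_fun setT (fun p : plane R * plane R => p.1 + p.2)%R.
Proof.
apply/measurable_fun_pairP; split; apply: measurable_funD.
- exact: (measurableT_comp measurable_fst measurable_fst).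
- exact: (measurableT_comp measurable_fst measurable_snd).
- exact: (measurableT_comp measurable_snd measurable_fst).
- exact: (measurableT_comp measurable_snd measurable_snd).
Qed.

Let increment (u : R) : {mfun Omega R >-> plane R} := HB.pack
  ((fun w => coord u w - coord 0 w)%R : Omega R -> plane R)
  (isMeasurableFun.Build _ _ _ _ _ (measurable_increment 0 u)).

Let gauss (u : R) : probability (plane R) R := distribution (W 0%R) (increment u).

Lemma brownian_increment z s u (A : set (Omega R)) (B : set (plane R)) :
  (0 <= s)%R -> (0 < u)%R -> filt s A -> measurable B ->
  W z (A `&` (fun w => coord (s + u) w - coord s w)%R @^-1` B) = W z A * gauss u B.
Proof.
move=> s0 u0 As mB.
have := (brownian_W z).2 s (s + u)%R; rewrite s0 ltrDl u0 => /(_ isT A B As mB).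
rewrite -addrA subrKC => ->; congr (_ * _).
have := (brownian_W 0%R).2 0%R u; rewrite lexx u0 => /(_ isT setT B (filtT _) mB).
by rewrite setTI probability_setT mul1e subr0.
Qed.

Section fix_f.
Variable f : plane R -> R.
Hypotheses (mf : measurable_fun setT f) (f0 : forall z, (0 <= f z)%R).

Let mfD (z : plane R) : measurable_fun setT (fun y : plane R => (f (z + y)%R)%:E).
Proof.
apply/measurable_EFinP; apply: (measurableT_comp mf).
exact: (measurableT_comp measurable_plane_add (pair1_measurable z)).
Qed.

Lemma integral_increment z s u (g : plane R -> \bar R) :
  (0 <= s)%R -> (0 < u)%R -> measurable_fun setT g -> (forall y, 0 <= g y) ->
  \int[W z]_w g (coord (s + u) w - coord s w)%R = \int[gauss u]_y g y.
Proof.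
move=> s0 u0 mg g0.
transitivity (\int[pushforward (W z) (fun w : Omega R => coord (s + u) w - coord s w)%R]_y g y).
  by rewrite ge0_integral_pushforward//; exact: measurable_increment.
have mD := measurable_increment s (s + u).
apply: eq_measure_integral => B mB _.
have := @brownian_increment z s u setT B s0 u0 (filtT _) mB.
by rewrite setTI probability_setT mul1e.
Qed.

(** Increments have the same law from every starting point, so the process started
    at z is, at a fixed time, the one started at 0 translated by z. *)
Lemma transitionE z u : (0 <= u)%R -> \int[W z]_w (f (coord u w))%:E = transition f z u.
Proof.
move=> u0.
transitivity (\int[W z]_w (f (z + (coord u w - coord 0 w))%R)%:E).
  apply: ge0_ae_eq_integral => //.
  - by apply/measurable_EFinP; exact: (measurableT_comp mf (measurable_coord u)).
  - exact: (measurableT_comp (mfD z) (measurable_increment 0 u)).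
  - by move=> w _; rewrite lee_fin.
  - by move=> w _; rewrite lee_fin.
  - apply: ae_impl (brownian_start z) => w wz _.
    by rewrite wz addrC subrK.
rewrite /transition; have [->|un0] := eqVneq u 0%R.
  under eq_integral do rewrite subrr.
  under [RHS]eq_integral do rewrite subrr.
  by rewrite !integral_cst//; congr (_ * _); exact: (etrans (WT _) (esym (WT _))).
have {un0} u1 : (0 < u)%R by rewrite lt_neqAle eq_sym un0.
have h y := @integral_increment y 0%R u (fun y => (f (z + y)%R)%:E) (lexx _) u1 (mfD z) (fun _ => _).
by rewrite add0r in h; rewrite !h// => y; rewrite lee_fin.
Qed.

Lemma transition_ge0 z u : 0 <= transition f z u.
Proof. by apply: integral_ge0 => w _; rewrite lee_fin. Qed.

Lemma measurable_transition : measurable_fun setT (fun p : plane R * R => transition f p.1 p.2).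
Proof.
pose F (p : (plane R * R) * Omega R) := (f (p.1.1 + (coord p.1.2 p.2 - coord 0 p.2))%R)%:E.
apply: (measurable_fun_fubini_tonelli_F (m2 := W 0%R) F); last first.
  by move=> p; rewrite lee_fin.
apply/measurable_EFinP; apply: (measurableT_comp mf).
have mc : measurable_fun setT (fun p : (plane R * R) * Omega R => coord p.1.2 p.2).
  exact: (measurableT_comp measurable_coord_pair
    (measurable_fun_pair (measurableT_comp measurable_snd measurable_fst) measurable_snd)).
have mc0 : measurable_fun setT (fun p : (plane R * R) * Omega R => coord 0 p.2).
  exact: (measurableT_comp (measurable_coord 0) measurable_snd).
have mz : measurable_fun setT (fun p : (plane R * R) * Omega R => p.1.1).
  exact: (measurableT_comp measurable_fst measurable_fst).
move: mc mc0 mz => /measurable_fun_pairP[c1 c2] /measurable_fun_pairP[d1 d2] /measurable_fun_pairP[z1 z2].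
by apply/measurable_fun_pairP; split; apply: measurable_funD => //; exact: measurable_funB.
Qed.

(** The semigroup property, from the independence of X_s and X_(s+u) - X_s. Together
    with the one-time laws it replaces the Markov property on path space. *)
Lemma chapman_kolmogorov s u : (0 <= s)%R -> (0 <= u)%R ->
  \int[W 0%R]_w (f (coord (s + u) w))%:E = \int[W 0%R]_w transition f (coord s w) u.
Proof.
move=> s0; rewrite le_eqVlt => /predU1P[<-|u0].
  rewrite addr0; apply: eq_integral => w _; rewrite /transition.
  under eq_integral do rewrite subrr addr0.
  by rewrite integral_cst// [X in _ = _ * X](WT 0%R) mule1.
pose g (p : plane R * plane R) := (f (p.1 + p.2)%R)%:E.
have mg : measurable_fun setT g.
  by apply/measurable_EFinP; exact: (measurableT_comp mf measurable_plane_add).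
transitivity (\int[W 0%R]_w g (coord s w, (coord (s + u) w - coord s w)%R)).
  by apply: eq_integral => w _; rewrite /g/= subrKC.
rewrite (@integral_independent _ _ _ (Omega R) (plane R) (plane R) R (W 0%R) (gauss u) (coord s) (fun w => coord (s + u) w - coord s w)%R)//.
- apply: eq_integral => w _; rewrite /transition.
  have := @integral_increment 0%R 0%R u (fun y => g (coord s w, y)) (lexx _) u0 (mfD _).
  by rewrite add0r => <-// y; rewrite lee_fin.
- exact: measurable_coord.
- exact: measurable_increment.
- move=> A B mA mB; apply: brownian_increment => //.
  by apply: filt_coord => //; rewrite s0 lexx.
- by move=> p; rewrite lee_fin.
Qed.

End fix_f.
End brownian.

(** * The potential of q along Brownian motion *)

Section finiteness.
Context {R : realType} (W : plane R -> probability (Omega R) R).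
Hypothesis brownian_W : forall z : plane R, brownian_law z (W z).
Local Open Scope ereal_scope.
Variables (q phi : plane R -> R) (c : R).
Hypotheses (mq : measurable_fun setT q) (q0 : forall z, (0 <= q z)%R).
Hypotheses (c0 : (0 < c)%R) (c_phi : forall z, (c <= phi z)%R).
Hypothesis cphi : continuous phi.
Hypothesis mart : forall z, martingale (W z) (penalisation_density q phi z).

Let phi_gt0 z : (0 < phi z)%R. Proof. exact: lt_le_trans (c_phi z). Qed.
Let phi_ge0 z : (0 <= phi z)%R. Proof. exact: ltW. Qed.
Let mphi : measurable_fun setT phi. Proof. exact: continuous_plane_measurable. Qed.

Let WT z : \int[W z]_w 1 = 1.
Proof. by rewrite integral_cst//= [X in _ * X](@probability_setT _ _ _ (W z)) mule1. Qed.

Lemma measurable_discount t :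
  measurable_fun [set: Omega R] (fun w => expeR (- (2^-1%:E * additive_functional q t w))).
Proof.
apply: (measurableT_comp (@measurable_expeR R)); apply: (measurableT_comp (@oppe_measurable R setT)).
by apply: measurable_funeM; exact: measurable_additive_functional.
Qed.

Lemma measurable_at t (f : plane R -> R) : measurable_fun setT f ->
  measurable_fun [set: Omega R] (fun w => (f (coord t w))%:E).
Proof. by move=> mf; apply/measurable_EFinP; exact: (measurableT_comp mf (measurable_coord t)). Qed.

(** Constancy of the expectation of the martingale between times 0 and h. *)
Lemma discounted_expectation z h : (0 <= h)%R ->
  \int[W z]_w ((phi (coord h w))%:E * expeR (- (2^-1%:E * additive_functional q h w))) =
  (phi z)%:E.
Proof.
move=> h0.
transitivity (\int[W z]_w ((phi z)%:E * penalisation_density q phi z h w)).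
  apply: eq_integral => w _; rewrite /penalisation_density muleA -EFinM.
  by rewrite mulrC divfK ?gt_eqF.
have mM t : measurable_fun [set: Omega R] (penalisation_density q phi z t).
  apply: emeasurable_funM; last exact: measurable_discount.
  apply: (measurable_at t (fun y => (phi y / phi z)%R)).
  exact: measurable_funM.
have M0 t w : 0 <= penalisation_density q phi z t w.
  by rewrite mule_ge0 ?expeR_ge0// lee_fin divr_ge0.
rewrite ge0_integralZl//; last by rewrite lee_fin.
have [_ _ /(_ 0%R h setT)] := mart z.
rewrite lexx h0 => /(_ isT (filtT _)) ->.
rewrite -[RHS]mule1 -[in RHS](WT z); congr (_ * _).
apply: ge0_ae_eq_integral => //.
apply: ae_impl (brownian_start _ brownian_W z) => w wz _.
rewrite /penalisation_density wz divff ?gt_eqF// additive_functional0.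
by rewrite mule0 oppe0 expeR0 mule1.
Qed.

(** The potential is truncated at level m so that its additive functional grows at
    most at speed m; the final bound does not depend on m. *)
Section truncated.
Variable m : R.
Hypothesis m0 : (0 <= m)%R.

Let qm z := Num.min (q z) m.

Let mqm : measurable_fun setT qm. Proof. exact: measurable_minr. Qed.
Let qm_ge0 z : (0 <= qm z)%R. Proof. by rewrite le_min q0. Qed.

Let A_m t w := additive_functional qm t w.

Let A_m_le t w : A_m t w <= additive_functional q t w.
Proof.
apply: ge0_le_integral => //.
- by move=> s _; rewrite lee_fin.
- exact: measurable_funTS (measurable_along_path _ mqm w).
- exact: measurable_funTS (measurable_along_path _ mq w).
- by move=> s _; rewrite lee_fin ge_min lexx.
Qed.

Let A_m_ub t w : (0 <= t)%R -> A_m t w <= (m * t)%:E.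
Proof.
move=> t0; apply: (@le_trans _ _ (\int[lebesgue_measure]_(s in `[0%R, t]) m%:E)).
  apply: ge0_le_integral => //.
  - by move=> s _; rewrite lee_fin.
  - exact: measurable_funTS (measurable_along_path _ mqm w).
  - by move=> s _; rewrite lee_fin ge_min lexx orbT.
rewrite integral_cst//= lebesgue_measure_itv/= lte_fin.
by case: ifPn => _; rewrite ?sube0 ?mule0 ?lee_fin ?mulr_ge0.
Qed.

Let integral_A_m z t :
  \int[W z]_w A_m t w = \int[lebesgue_measure]_(u in `[0%R, t]) \int[W z]_w (qm (coord u w))%:E.
Proof.
apply: (@tonelli_restricted _ _ (Omega R) _ _ (fun p => (qm (coord p.1 p.2))%:E)) => //.
- exact: measurable_along_paths.
- by move=> p; rewrite lee_fin.
Qed.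

(** The undiscounted value of phi exceeds the discounted one, of expectation phi z,
    by a multiple of the truncated functional: this is [discount_gap] integrated.
    Only Gaussian averages appear in the result, so that it can be iterated with the semigroup
    property alone. *)
Lemma drift z h : (0 <= h)%R -> (m * h <= 1)%R ->
  (phi z)%:E + (c / 4)%:E * \int[lebesgue_measure]_(u in `[0%R, h]) transition W qm z u <=
  transition W phi z h.
Proof.
move=> h0 mh; rewrite -(transitionE _ brownian_W)//.
have -> : \int[lebesgue_measure]_(u in `[0%R, h]) transition W qm z u = \int[W z]_w A_m h w.
  rewrite integral_A_m; apply: eq_integral => u; rewrite inE/= in_itv/= => /andP[u0 _].
  by rewrite (transitionE _ brownian_W).
have mAm : measurable_fun [set: Omega R] (A_m h) by exact: measurable_additive_functional.
have Am0 w : 0 <= A_m h w by exact: additive_functional_ge0.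
have c4 : (0 <= c / 4)%R by rewrite divr_ge0// ltW.
rewrite -(discounted_expectation z h)// -ge0_integralZl// -ge0_integralD//.
- apply: ge0_le_integral => //.
  + by move=> w _; rewrite adde_ge0 ?mule_ge0 ?expeR_ge0 ?lee_fin.
  + apply: emeasurable_funD; last exact: measurable_funeM.
    by apply: emeasurable_funM; [exact: measurable_at|exact: measurable_discount].
  + exact: measurable_at.
  + move=> w _; apply: discount_gap => //.
    * exact: le_trans (A_m_ub _ _ _) _.
    * exact: ltW.
- by move=> w _; rewrite mule_ge0 ?expeR_ge0 ?lee_fin.
- by apply: emeasurable_funM; [exact: measurable_at|exact: measurable_discount].
- by move=> w _; rewrite mule_ge0 ?lee_fin.
- exact: measurable_funeM.
Qed.

Let g t := \int[W 0%R]_w (phi (coord t w))%:E.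
Let v t := \int[W 0%R]_w (qm (coord t w))%:E.

Let mv : measurable_fun setT v.
Proof.
apply: (measurable_fun_fubini_tonelli_F (m2 := W 0%R) (fun p => (qm (coord p.1 p.2))%:E)).
  exact: measurable_along_paths.
by move=> p; rewrite lee_fin.
Qed.

Let v0 t : 0 <= v t.
Proof. by apply: integral_ge0 => w _; rewrite lee_fin. Qed.

(** [drift] at the point X_s, averaged over the law of X_s. *)
Lemma drift_step s h : (0 <= s)%R -> (0 <= h)%R -> (m * h <= 1)%R ->
  g s + (c / 4)%:E * \int[lebesgue_measure]_(u in `[s, (s + h)%R]) v u <= g (s + h)%R.
Proof.
move=> s0 h0 mh.
have c4 : (0 <= c / 4)%R by rewrite divr_ge0// ltW.
rewrite /g chapman_kolmogorov//.
rewrite -[X in `[X, _]](addr0 s) ge0_integral_shift//.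
pose F (p : R * Omega R) := transition W qm (coord s p.2) p.1.
have mF : measurable_fun setT F.
  apply: (measurableT_comp (measurable_transition W _ mqm qm_ge0)
     (measurable_fun_pair (measurableT_comp (measurable_coord s) measurable_snd) measurable_fst)).
have F0 p : 0 <= F p by exact: transition_ge0.
have -> : \int[lebesgue_measure]_(u in `[0%R, h]) v (s + u)%R =
    \int[W 0%R]_w \int[lebesgue_measure]_(u in `[0%R, h]) F (u, w).
  rewrite (@tonelli_restricted _ _ (Omega R))//.
  apply: eq_integral => u; rewrite inE/= in_itv/= => /andP[u0 _].
  by rewrite /v chapman_kolmogorov.
have mI := @measurable_integral_restricted R _ (Omega R) `[0%R, h]%classic (measurable_itv _) F mF F0.
rewrite -ge0_integralZl//; last by move=> w _; exact: integral_ge0.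
have mphis : measurable_fun [set: Omega R] (fun w => (phi (coord s w))%:E) by exact: measurable_at.
rewrite -ge0_integralD//; last 3 first.
- by move=> w _; rewrite lee_fin.
- by move=> w _; rewrite mule_ge0 ?lee_fin//; exact: integral_ge0.
- exact: measurable_funeM.
apply: ge0_le_integral => //.
- by move=> w _; rewrite adde_ge0 ?lee_fin// mule_ge0 ?lee_fin//; exact: integral_ge0.
- by apply: emeasurable_funD => //; exact: measurable_funeM.
- exact: (measurableT_comp (measurable_transition W _ mphi phi_ge0)
     (measurable_fun_pair (measurable_coord s) (measurable_cst h))).
- by move=> w _; exact: drift.
Qed.

Lemma drift_sum n h : (0 <= h)%R -> (m * h <= 1)%R ->
  (c / 4)%:E * \int[lebesgue_measure]_(u in `[0%R, (n%:R * h)%R]) v u <= g (n%:R * h)%R.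
Proof.
move=> h0 mh; elim: n => [|n IH].
  by rewrite mul0r set_itv1 integral_set1 mule0 integral_ge0// => w _; rewrite lee_fin.
have nh0 : (0 <= n%:R * h)%R by rewrite mulr_ge0.
have -> : (n.+1%:R * h = n%:R * h + h)%R by rewrite -natr1 mulrDl mul1r.
apply: le_trans (drift_step _ _ nh0 h0 mh).
apply: le_trans (leeD IH (lexx _)).
have c4 : (0 <= c / 4)%R by rewrite divr_ge0// ltW.
rewrite -ge0_muleDr ?integral_ge0// lee_wpmul2l ?lee_fin//.
rewrite (@itv_bndbnd_setU _ _ _ (BRight (n%:R * h)%R)) ?bnd_simp ?lerDl//.
rewrite ge0_integral_setU//=; last 2 first.
- exact: measurable_funTS.
- rewrite disj_set2E; apply/eqP/seteqP; split => // u [/=]; rewrite !in_itv/=.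
  by move=> /andP[_ u1] /andP[u2 _]; have := lt_le_trans u2 u1; rewrite ltxx.
by rewrite integral_itv_obnd_cbnd//; exact: measurable_funTS.
Qed.

(** A mesh t / n with m t <= n makes every step short enough, and the steps
    telescope. *)
Lemma truncated_bound t : (0 <= t)%R ->
  (c / 4)%:E * \int[W 0%R]_w A_m t w <= g t.
Proof.
move=> t0; rewrite integral_A_m.
pose n := (Num.truncn (m * t)).+1.
have n0 : (0 < n%:R :> R)%R by [].
have -> : t = (n%:R * (t / n%:R))%R by rewrite mulrC divfK ?gt_eqF.
apply: drift_sum; first by rewrite divr_ge0// ltW.
by rewrite mulrA ler_pdivrMr// mul1r ltW// /n truncnS_gt.
Qed.

End truncated.
End finiteness.

(** * Functions growing like the logarithm *)

Section asymptotics.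
Context {R : realType}.
Implicit Types phi : plane R -> R.

Definition log_asymptotic phi := phi z / ln (cmod z) @[z --> cinfty] --> pi^-1.

Lemma log_asymptotic_bounds phi : log_asymptotic phi ->
  exists2 r, 1 <= r & forall z, r < cmod z ->
    ln (cmod z) / (2 * pi) <= phi z <= ln (cmod z).
Proof.
move=> /cvgrPdist_le /(_ (2 * pi)^-1).
have pi0 : (0 : R) < pi := pi_gt0 R.
have p2 : (0 : R) < (2 * pi)^-1 by rewrite invr_gt0 mulr_gt0.
move=> /(_ p2)[r _ rphi]; exists (Num.max 1 r); first by rewrite le_max lexx.
move=> z; rewrite gt_max => /andP[z1 rz].
have := rphi z rz; rewrite /= ler_distlC => /andP[lo hi].
have ln0 : 0 < ln (cmod z) by rewrite ln_gt0.
have pE : pi^-1 = 2 * (2 * pi)^-1 :> R by rewrite invfM mulrA divff// mul1r.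
have p4 : (2 * pi)^-1 <= 4^-1 :> R.
  by rewrite lef_pV2 ?posrE ?mulr_gt0//; have := pi_ge2 R; lra.
rewrite -(divfK (lt0r_neq0 ln0) (phi z)).
move: pE p4 lo hi; move: (_ / ln _) (2 * pi)^-1 (pi^-1) => x p p' pE p4 lo hi.
apply/andP; split.
  by rewrite mulrC ler_wpM2r ?(ltW ln0)//; lra.
by rewrite -[leRHS]mul1r ler_wpM2r ?(ltW ln0)//; lra.
Qed.

Lemma log_asymptotic_large phi (K : R) : log_asymptotic phi ->
  exists r, forall z, r < cmod z -> K <= phi z.
Proof.
move=> /log_asymptotic_bounds[r r1 rphi].
have pi0 : (0 : R) < pi := pi_gt0 R.
exists (Num.max r (expR (2 * pi * K))) => z; rewrite gt_max => /andP[rz Kz].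
have /andP[lo _] := rphi z rz; apply: le_trans lo.
have z0 : 0 < cmod z := lt_trans (expR_gt0 _) Kz.
by rewrite ler_pdivlMr ?mulr_gt0// mulrC -ler_expR lnK ?posrE// ltW.
Qed.

Lemma log_asymptotic_lower_bound phi : (forall z, 0 < phi z) -> continuous phi ->
  log_asymptotic phi -> exists2 c, 0 < c & forall z, c <= phi z.
Proof.
move=> phi0 cphi /(log_asymptotic_large _ 1)[r rphi].
have [|z rz|K phiK] := @plane_bounded R (fun z => (phi z)^-1) r 1.
- by move=> z; apply: cvgV; [rewrite gt_eqF|exact: cphi].
- by rewrite invf_le1// rphi.
have K0 : 0 < K by apply: lt_le_trans (phiK 0); rewrite invr_gt0.
exists K^-1; first by rewrite invr_gt0.
by move=> z; rewrite -[leRHS]invrK lef_pV2 ?posrE ?invr_gt0.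
Qed.

Lemma log_asymptotic_ratio phi psi : log_asymptotic phi -> log_asymptotic psi ->
  psi z / phi z @[z --> cinfty] --> (1 : R).
Proof.
have pi0 : (0 : R) < pi := pi_gt0 R.
move=> hphi hpsi.
have -> : (1 : R) = pi^-1 / pi^-1 by rewrite divff// invr_eq0 gt_eqF.
have := cvgM hpsi (cvgV _ hphi); rewrite invr_eq0 gt_eqF// => /(_ _ _ isT).
apply: cvg_trans; apply: near_eq_cvg.
exists 1 => // z z1 /=.
by rewrite invf_div mulrA divfK// gt_eqF// ln_gt0.
Qed.

Lemma log_asymptotic_ratio_bounded phi psi : (forall z, 0 < phi z) ->
  continuous phi -> continuous psi ->
  log_asymptotic phi -> log_asymptotic psi ->
  exists K, forall z, psi z / phi z <= K.
Proof.
move=> phi0 cphi cpsi hphi hpsi.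
have /cvgrPdist_le/(_ 1 ltr01)[r _ h] := log_asymptotic_ratio _ _ hphi hpsi.
apply: (plane_bounded _ _ r 2).
  by move=> z; apply: cvgM; [exact: cpsi|apply: cvgV; [rewrite gt_eqF|exact: cphi]].
by move=> z /h /=; rewrite ler_distlC => /andP[_]; lra.
Qed.

(** With the factor 4 the weight is still integrable for the centred normal law of
    variance t, whose density decays like exp(- x^2 / (2 t)). *)
Definition gauss_weight (t x : R) := expR (x ^+ 2 / (4 * t)).

Lemma continuous_gauss_weight t : continuous (gauss_weight t).
Proof.
move=> x; apply: continuous_comp; last exact: continuous_expR.
by apply: cvgM; [exact: sqr_continuous|exact: cvg_cst].
Qed.

Lemma log_asymptotic_growth phi t : 0 < t -> continuous phi -> log_asymptotic phi ->
  exists2 K, 0 <= K & forall z, phi z <= K * (gauss_weight t z.1 + gauss_weight t z.2).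
Proof.
move=> t0 cphi /log_asymptotic_bounds[r r1 rphi].
pose D z := gauss_weight t z.1 + gauss_weight t z.2.
have D0 z : 0 < D z by rewrite addr_gt0// expR_gt0.
have cD : continuous D.
  move=> z; apply: cvgD.
    apply: (@continuous_comp _ _ _ fst (gauss_weight t)); first exact: cvg_fst.
    exact: continuous_gauss_weight.
  apply: (@continuous_comp _ _ _ snd (gauss_weight t)); first exact: cvg_snd.
  exact: continuous_gauss_weight.
have [|z rz|K phiK] := @plane_bounded R (fun z => phi z / D z) r (2 * t).
- by move=> z; apply: cvgM; [exact: cphi|apply: cvgV; [rewrite gt_eqF|exact: cD]].
- rewrite ler_pdivrMr//.
  have /andP[_ hi] := rphi z rz; apply: le_trans hi _.
  have z0 : 0 < cmod z by apply: lt_trans rz; exact: lt_le_trans r1.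
  have zz : 0 <= z.1 ^+ 2 + z.2 ^+ 2 by rewrite addr_ge0// sqr_ge0.
  have lnz : ln (cmod z) <= (z.1 ^+ 2 + z.2 ^+ 2) / 2.
    have h2 : 2 * ln (cmod z) = ln (z.1 ^+ 2 + z.2 ^+ 2).
      by rewrite mulr_natl -lnXn// /cmod sqr_sqrtr.
    have : ln (z.1 ^+ 2 + z.2 ^+ 2) <= z.1 ^+ 2 + z.2 ^+ 2.
      have [->|n0] := eqVneq (z.1 ^+ 2 + z.2 ^+ 2) 0; first by rewrite ln0.
      have p0 : 0 < z.1 ^+ 2 + z.2 ^+ 2 by rewrite lt_neqAle eq_sym n0.
      rewrite -ler_expR lnK ?posrE//; apply: le_trans (expR_ge1Dx _); lra.
    lra.
  apply: le_trans lnz _.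
  have e (x : R) : x ^+ 2 / (4 * t) <= gauss_weight t x.
    by apply: le_trans (expR_ge1Dx _); lra.
  have := lerD (e z.1) (e z.2); rewrite -mulrDl ler_pdivrMr ?mulr_gt0// -/(D z).
  lra.
exists (Num.max 0 K); first by rewrite le_max lexx.
move=> z; rewrite -ler_pdivrMr; last exact: D0.
by rewrite le_max phiK orbT.
Qed.

End asymptotics.

(** * Gaussian estimates *)

Section gaussian.
Context {R : realType} (W : plane R -> probability (Omega R) R).
Hypothesis brownian_W : forall z : plane R, brownian_law z (W z).
Local Open Scope ereal_scope.

Let normalT s : normal_prob (0 : R)%R s setT = 1.
Proof. exact: probability_setT. Qed.

Let marginal (p : plane R -> R) (t : R) (g : R -> \bar R) :
  measurable_fun setT p -> p 0%R = 0%R ->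
  (forall B : set R, measurable B ->
    (normal_prob 0%R (Num.sqrt t) \x normal_prob 0%R (Num.sqrt t)) (p @^-1` B) =
    normal_prob 0%R (Num.sqrt t) B) ->
  (0 < t)%R -> measurable_fun setT g -> (forall y, 0 <= g y) ->
  \int[W 0%R]_w g (p (coord t w)) =
  \int[lebesgue_measure]_y (g y * (normal_pdf 0%R (Num.sqrt t) y)%:E).
Proof.
move=> mp p0 pB t0 mg g0.
have mX : measurable_fun [set: Omega R] (fun w => p (coord t w - coord 0 w)%R).
  exact: (measurableT_comp mp (measurable_increment 0 t)).
pose X (w : Omega R) : measurableTypeR R := p (coord t w - coord 0 w)%R.
have mX' : measurable_fun setT X := mX.
transitivity (\int[W 0%R]_w g (p (coord t w - coord 0 w)%R)).
  apply: ge0_ae_eq_integral => //.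
  - exact: (measurableT_comp mg (measurableT_comp mp (measurable_coord t))).
  - exact: (measurableT_comp mg mX).
  - by apply: ae_impl (brownian_start _ brownian_W 0%R) => w -> _; rewrite subr0.
rewrite -(@integral_density _ _ R lebesgue_measure (normal_prob 0%R (Num.sqrt t)))//.
- transitivity (\int[pushforward (W 0%R) X]_y g y).
    by rewrite ge0_integral_pushforward.
  apply: eq_measure_integral => B mB _.
  have := (brownian_W 0%R).2 0%R t; rewrite lexx t0 subr0 => /(_ isT setT (p @^-1` B) (filtT _)).
  rewrite setTI probability_setT mul1e pB//; apply.
  by rewrite -[X in measurable X]setTI; exact: mp.
- by apply/measurable_EFinP; exact: measurable_normal_pdf.
- by move=> y; rewrite lee_fin normal_pdf_ge0.
Qed.

Lemma marginal_re t (g : R -> \bar R) :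
  (0 < t)%R -> measurable_fun setT g -> (forall y, 0 <= g y) ->
  \int[W 0%R]_w g (coord t w).1 =
  \int[lebesgue_measure]_y (g y * (normal_pdf 0%R (Num.sqrt t) y)%:E).
Proof.
apply: (marginal fst) => // B mB; rewrite (_ : fst @^-1` B = B `*` setT); last first.
  by apply/seteqP; split=> x /=; [split|case].
rewrite -[RHS]mule1 -(normalT (Num.sqrt t)); apply: product_measure1E => //; exact: measurableT.
Qed.

Lemma marginal_im t (g : R -> \bar R) :
  (0 < t)%R -> measurable_fun setT g -> (forall y, 0 <= g y) ->
  \int[W 0%R]_w g (coord t w).2 =
  \int[lebesgue_measure]_y (g y * (normal_pdf 0%R (Num.sqrt t) y)%:E).
Proof.
apply: (marginal snd) => // B mB; rewrite (_ : snd @^-1` B = setT `*` B); last first.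
  by apply/seteqP; split=> x /=; [split|case].
rewrite -[RHS]mul1e -{1}(normalT (Num.sqrt t)); apply: product_measure1E => //; exact: measurableT.
Qed.

(** Weight times density is a multiple of the normal density of variance 2 t. *)
Lemma gauss_weight_expectation (t : R) : (0 < t)%R ->
  \int[lebesgue_measure]_y ((gauss_weight t y)%:E * (normal_pdf 0%R (Num.sqrt t) y)%:E) < +oo.
Proof.
move=> t0.
have st : Num.sqrt t != 0%R by rewrite gt_eqF// sqrtr_gt0.
have s2t : Num.sqrt (2 * t) != 0%R by rewrite gt_eqF// sqrtr_gt0 mulr_gt0.
pose k := (normal_peak (Num.sqrt t) / normal_peak (Num.sqrt (2 * t)))%R.
have pk : (0 < normal_peak (Num.sqrt (2 * t)))%R by exact: normal_peak_gt0.
have k0 : (0 <= k)%R by rewrite divr_ge0// normal_peak_ge0.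
under eq_integral => y _.
  rewrite -EFinM (_ : (_ * _)%R = (k * normal_pdf 0 (Num.sqrt (2 * t)) y)%R).
    rewrite EFinM; over.
  rewrite !normal_pdfE// /k [RHS]mulrA divfK ?gt_eqF// mulrCA; congr (_ * _)%R.
  rewrite /gauss_weight /normal_fun -expRD subr0 !sqr_sqrtr ?mulr_ge0 ?(ltW t0)//.
  by congr expR; field; rewrite gt_eqF.
rewrite ge0_integralZl//.
- by rewrite integral_normal_pdf mule1 ltry.
- by apply/measurable_EFinP; exact: measurable_normal_pdf.
- by move=> y _; rewrite lee_fin normal_pdf_ge0.
Qed.

Lemma expectation_lty (phi : plane R -> R) t : (0 < t)%R ->
  (forall z, (0 <= phi z)%R) -> continuous phi -> log_asymptotic phi ->
  \int[W 0%R]_w (phi (coord t w))%:E < +oo.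
Proof.
move=> t0 phi0 cphi hphi.
have [K K0 phiK] := log_asymptotic_growth phi t t0 cphi hphi.
have mw : measurable_fun setT (fun x : R => (gauss_weight t x)%:E).
  apply/measurable_EFinP.
  by apply: continuous_measurable_fun; exact: continuous_gauss_weight.
have m1 : measurable_fun [set: Omega R] (fun w => (gauss_weight t (coord t w).1)%:E).
  exact: (measurableT_comp mw (measurableT_comp measurable_fst (measurable_coord t))).
have m2 : measurable_fun [set: Omega R] (fun w => (gauss_weight t (coord t w).2)%:E).
  exact: (measurableT_comp mw (measurableT_comp measurable_snd (measurable_coord t))).
have w0 x : 0 <= (gauss_weight t x)%:E by rewrite lee_fin expR_ge0.
apply: (@le_lt_trans _ _ (\int[W 0%R]_w (K%:E * ((gauss_weight t (coord t w).1)%:E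
  + (gauss_weight t (coord t w).2)%:E)))).
  apply: ge0_le_integral => //.
  - by move=> w _; rewrite lee_fin.
  - by apply: measurable_at; exact: continuous_plane_measurable.
  - by apply: measurable_funeM; exact: emeasurable_funD.
  - by move=> w _; rewrite -EFinD -EFinM lee_fin.
rewrite ge0_integralZl//; last 2 first.
- exact: emeasurable_funD.
- by move=> w _; rewrite adde_ge0.
rewrite ge0_integralD// (marginal_re t (fun x => (gauss_weight t x)%:E))//.
rewrite (marginal_im t (fun x => (gauss_weight t x)%:E))//.
have I := gauss_weight_expectation t t0.
by apply: lte_mul_pinfty => //; exact: lte_add_pinfty.
Qed.

(** The normal density is bounded by its peak, which vanishes as t grows. *)
Lemma small_strip t r : (0 < t)%R -> (0 <= r)%R ->
  W 0%R ((fun w : Omega R => (coord t w).1) @^-1` `[(- r)%R, r]%classic) <=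
  (normal_peak (Num.sqrt t) * (2 * r))%:E.
Proof.
move=> t0 r0.
have st : Num.sqrt t != 0%R by rewrite gt_eqF// sqrtr_gt0.
pose B : set R := `[(- r)%R, r]%classic.
have mB : measurable B by exact: measurable_itv.
have mI : measurable_fun setT (fun x : R => (\1_B x : R)%:E).
  by apply/measurable_EFinP; exact: measurable_indic.
have mC : measurable (((fun w : Omega R => (coord t w).1) : Omega R -> R) @^-1` B).
  rewrite -[X in measurable X]setTI.
  exact: (measurableT_comp measurable_fst (measurable_coord t)).
have -> : W 0%R ((fun w : Omega R => (coord t w).1) @^-1` B) =
    \int[W 0%R]_w (\1_B (coord t w).1)%:E.
  transitivity (\int[W 0%R]_w (\1_((fun w : Omega R => (coord t w).1) @^-1` B) w)%:E) => //.
  by rewrite integral_indic// setIT.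
rewrite (marginal_re t (fun x => (\1_B x)%:E))//.
apply: (@le_trans _ _ (\int[lebesgue_measure]_(y in B) (normal_peak (Num.sqrt t))%:E)).
  rewrite [leRHS]integral_mkcond; apply: ge0_le_integral => //.
  - by move=> y _; rewrite mule_ge0 ?lee_fin ?normal_pdf_ge0.
  - by apply: emeasurable_funM => //; apply/measurable_EFinP; exact: measurable_normal_pdf.
  - apply/(measurable_restrictT _ _).1 => //.
  - move=> y _; rewrite patchE indicE; case: ifPn => _; last by rewrite mul0e.
    by rewrite mul1e lee_fin normal_pdf_ub.
rewrite integral_cst//= lebesgue_measure_itv/= lte_fin; case: ifPn => _.
  rewrite lee_fin ler_wpM2l ?normal_peak_ge0//; lra.
by rewrite mule0 lee_fin !mulr_ge0 ?normal_peak_ge0.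
Qed.

End gaussian.

(** * Finiteness of the additive functional *)

Section almost_sure_finiteness.
Context {R : realType} (W : plane R -> probability (Omega R) R).
Hypothesis brownian_W : forall z : plane R, brownian_law z (W z).
Local Open Scope ereal_scope.

Lemma min_nat_cvg (a : R) : ((Num.min a n%:R)%:E @[n --> \oo] --> a%:E).
Proof.
apply: cvg_near_cst; near=> n; congr EFin; apply/min_idPl.
by near: n; exact: nbhs_infty_ger.
Unshelve. all: by end_near. Qed.

Lemma additive_functional_truncation (q : plane R -> R) (t : R) (w : path R) :
  measurable_fun setT q -> (forall z, (0 <= q z)%R) ->
  additive_functional (fun z => Num.min (q z) n%:R) t w @[n --> \oo] -->
  additive_functional q t w.
Proof.
move=> mq q0.
have -> : additive_functional q t w = \int[lebesgue_measure]_(s in `[0%R, t])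
    limn (fun n => (Num.min (q (coord s w)) n%:R)%:E).
  by apply: eq_integral => s _; apply/esym/cvg_lim => //; exact: min_nat_cvg.
apply: cvg_monotone_convergence => //.
- move=> n; apply: measurable_funTS.
  apply: (measurable_along_path (fun z => Num.min (q z) n%:R)).
  exact: measurable_minr.
- by move=> n s _; rewrite lee_fin le_min q0/=.
- by move=> s _ a b ab; rewrite lee_fin le_min2 ?ler_nat.
Qed.

(** Monotone limit of [truncated_bound] as the truncation level grows. *)
Lemma potential_bound (q phi : plane R -> R) (c t : R) :
  measurable_fun setT q -> (forall z, (0 <= q z)%R) ->
  (0 < c)%R -> (forall z, (c <= phi z)%R) -> continuous phi ->
  (forall z, martingale (W z) (penalisation_density q phi z)) -> (0 <= t)%R ->
  (c / 4)%:E * \int[W 0%R]_w additive_functional q t w <=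
  \int[W 0%R]_w (phi (coord t w))%:E.
Proof.
move=> mq q0 c0 cphi contphi mart t0.
pose A_ n (w : Omega R) := additive_functional (fun z => Num.min (q z) n%:R) t w.
have mqn n : measurable_fun setT (fun z => Num.min (q z) n%:R) by exact: measurable_minr.
have qn0 n z : (0 <= Num.min (q z) n%:R)%R by rewrite le_min q0/=.
have : (c / 4)%:E * \int[W 0%R]_w A_ n w @[n --> \oo] -->
    (c / 4)%:E * \int[W 0%R]_w additive_functional q t w.
  apply: cvgeZl => //.
  have -> : \int[W 0%R]_w additive_functional q t w = \int[W 0%R]_w limn (A_ ^~ w).
    apply: eq_integral => w _; apply/esym/cvg_lim => //.
    exact: additive_functional_truncation.
  apply: cvg_monotone_convergence => //.
  - by move=> n; exact: measurable_additive_functional.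
  - by move=> n w _; exact: additive_functional_ge0.
  - move=> w _ a b ab; apply: ge0_le_integral => //.
    + by move=> s _; rewrite lee_fin.
    + exact: measurable_funTS (measurable_along_path _ (mqn a) w).
    + exact: measurable_funTS (measurable_along_path _ (mqn b) w).
    + by move=> s _; rewrite lee_fin le_min2 ?ler_nat.
move=> /[dup] h /cvg_lim <- //; apply: lime_le; first by apply/cvg_ex; eexists; exact: h.
apply: nearW => n; exact: (truncated_bound W brownian_W q phi c).
Qed.

(** This rests on phi being finite, continuous and bounded below: its Gaussian
    averages are finite and dominate the expected functional. *)
Lemma additive_functional_lty (q phi : plane R -> R) (t : R) :
  classI q -> phi_properties W q phi -> (0 <= t)%R ->
  {ae W 0%R, forall w, additive_functional q t w < +oo}.
Proof.
move=> [mq q0 _ _ _] [phi0 contphi asym _ mart].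
rewrite le_eqVlt => /predU1P[<-|t0].
  by apply: aeW => w; rewrite additive_functional0 ltry.
have [c c0 cphi] := log_asymptotic_lower_bound phi phi0 contphi asym.
have c4 : (0 < c / 4)%R by rewrite divr_gt0.
have mA : measurable_fun [set: Omega R] (additive_functional q t).
  exact: measurable_additive_functional.
have A0 w : 0 <= additive_functional q t w by exact: additive_functional_ge0.
have fin : (\int[W 0%R]_w additive_functional q t w < +oo).
  have := le_lt_trans (potential_bound q phi c t mq q0 c0 cphi contphi mart (ltW t0))
    (expectation_lty W brownian_W phi t t0 (fun z => ltW (phi0 z)) contphi asym).
  by move=> h; rewrite ltNge leye_eq; apply/eqP => Aoo; move: h; rewrite Aoo gt0_muley ?lte_fin.
have /integrable_ae : (W 0%R).-integrable [set: Omega R] (additive_functional q t).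
  apply/integrableP; split => //.
  by under eq_integral do rewrite gee0_abs//.
move=> /(_ measurableT); apply: ae_impl => w /(_ I).
by rewrite ge0_fin_numE.
Qed.

End almost_sure_finiteness.

(** * Change of measure at a fixed time *)

(** The path space with the events up to time t only, so that adapted means
    measurable on this type. *)
Definition Filt (R : realType) (t : R) : Type :=
  g_sigma_algebraType (\bigcup_(s in [set s | 0 <= s <= t])
        preimage_set_system [set: path R] (coord s) measurable).

HB.instance Definition _ (R : realType) (t : R) := Measurable.on (Filt R t).

Section change_of_measure.
Context {R : realType}.
Local Open Scope ereal_scope.
Variables (W P : probability (Omega R) R) (t : R) (M : path R -> \bar R).
Hypotheses (t0 : (0 <= t)%R) (mM : measurable_fun [set: Filt R t] M).
Hypotheses (M0 : forall w, 0 <= M w) (Mfin : forall w, M w \is a fin_num).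
Hypothesis PM : forall A, filt t A -> P A = \int[W]_(w in A) M w.

Lemma measurable_Filt_id : measurable_fun [set: Omega R] (fun w => w : Filt R t).
Proof. by move=> _ B mB; rewrite setTI; exact: (filt_measurable t). Qed.

Lemma measurable_Filt_Omega (f : path R -> \bar R) :
  measurable_fun [set: Filt R t] f -> measurable_fun [set: Omega R] f.
Proof. by move=> mf; exact: (measurableT_comp mf measurable_Filt_id). Qed.

(** [integral_density] on the space of events up to time t, where P has density M
    with respect to W. *)
Lemma change_of_measure (f : path R -> \bar R) :
  measurable_fun [set: Filt R t] f -> (forall w, 0 <= f w) ->
  \int[P]_w f w = \int[W]_w (f w * M w).
Proof.
move=> mf f0.
pose i (w : Omega R) : Filt R t := w.
have mi : measurable_fun setT i := measurable_Filt_id.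
transitivity (\int[pushforward P i]_w f w); first by rewrite ge0_integral_pushforward.
rewrite (@integral_density _ (Filt R t) R (pushforward W i) (pushforward P i) M)//.
- rewrite ge0_integral_pushforward//; last by move=> w _; rewrite mule_ge0.
  exact: emeasurable_funM.
- move=> A mA; rewrite ge0_integral_pushforward//; first exact: PM.
  exact: measurable_funTS.
Qed.

End change_of_measure.

Section penalised.
Context {R : realType} (W : plane R -> probability (Omega R) R).
Hypothesis brownian_W : forall z : plane R, brownian_law z (W z).
Local Open Scope ereal_scope.

Definition penalised_triple (q phi : plane R -> R) (P : probability (Omega R) R) :=
  [/\ classI q, phi_properties W q phi, penalised_law (W (0%R, 0%R)) q phi (0%R, 0%R) P &
    transient P].

Lemma measurable_Filt_coord (t : R) (f : plane R -> R) :
  (0 <= t)%R -> measurable_fun setT f ->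
  measurable_fun [set: Filt R t] (fun w => (f (coord t w))%:E).
Proof.
move=> t0 mf; apply/measurable_EFinP; apply: (measurableT_comp mf).
by move=> _ B mB; rewrite setTI; apply: filt_coord => //; rewrite t0 lexx.
Qed.

Section one_triple.
Variables (q phi : plane R -> R).
Hypotheses (qI : classI q) (phiP : phi_properties W q phi).

Let mq : measurable_fun setT q. Proof. by case: qI. Qed.
Let q0 z : (0 <= q z)%R. Proof. by case: qI. Qed.
Let phi_gt0 z : (0 < phi z)%R. Proof. by case: phiP. Qed.
Let cphi : continuous phi. Proof. by case: phiP. Qed.
Let mphi : measurable_fun setT phi. Proof. exact: continuous_plane_measurable. Qed.
Let M := penalisation_density q phi (0%R, 0%R).

Lemma discount_ge0 t w : 0 <= discount q t w.
Proof. exact: expeR_ge0. Qed.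

Lemma discount_le1 t w : discount q t w <= 1.
Proof.
rewrite -expeR0 lee_expeR oppe_le0 mule_ge0 ?lee_fin//.
exact: additive_functional_ge0.
Qed.

Lemma discount_fin_num t w : discount q t w \is a fin_num.
Proof. by rewrite ge0_fin_numE ?discount_ge0// (le_lt_trans (discount_le1 t w))// ltry. Qed.

Lemma penalisation_densityE t w :
  M t w = (phi (coord t w) / phi (0%R, 0%R))%:E * discount q t w.
Proof. by []. Qed.

Lemma penalisation_density_ge0 t w : 0 <= M t w.
Proof. by rewrite mule_ge0 ?expeR_ge0// lee_fin divr_ge0// ltW. Qed.

Lemma penalisation_density_fin_num t w : M t w \is a fin_num.
Proof. by rewrite penalisation_densityE fin_numM// discount_fin_num. Qed.

Lemma measurable_Filt_density (t : R) : (0 <= t)%R -> measurable_fun [set: Filt R t] (M t).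
Proof.
move=> t0 _ B mB; rewrite setTI.
by case: phiP => _ _ _ _ /(_ (0%R, 0%R))[h _ _]; exact: h.
Qed.

(** Adaptedness of the discount is read off that of the martingale, whose other
    factor is positive. *)
Lemma measurable_Filt_discount (t : R) : (0 <= t)%R ->
  measurable_fun [set: Filt R t] (discount q t).
Proof.
move=> t0.
have -> : discount q t = fun w => M t w * (phi (0%R, 0%R) / phi (coord t w))%:E.
  apply/funext => w; rewrite penalisation_densityE muleAC -EFinM.
  by rewrite mulrA divfK ?gt_eqF// divff ?gt_eqF// mul1e.
apply: emeasurable_funM; first exact: measurable_Filt_density.
apply: (measurable_Filt_coord t (fun z => (phi (0%R, 0%R) / phi z)%R)) => //.
apply: measurable_funM => //; apply: continuous_plane_measurable => z.
by apply: cvgV; [rewrite gt_eqF|exact: cphi].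
Qed.

Lemma measurable_Filt_additive_functional (t : R) : (0 <= t)%R ->
  measurable_fun [set: Filt R t] (additive_functional q t).
Proof.
move=> t0 _; apply: (measurability _ (ErealGenOInfty.measurableE R)) => //.
move=> _ [_ [r ->] <-]; rewrite setTI.
have [e eE] : exists e, e = expeR (- (2^-1%:E * r%:E)) by eexists.
have -> : additive_functional q t @^-1` `]r%:E, +oo[ = discount q t @^-1` `]-oo, e[.
  have i2 : 0 < (2^-1)%:E :> \bar R by rewrite lte_fin invr_gt0.
  by apply/seteqP; split=> w /=; rewrite !in_itv/= ?andbT /discount eE lte_expeR lteN2 lte_pmul2l.
rewrite -[X in measurable X]setTI; apply: measurable_Filt_discount => //.
exact: emeasurable_itv.
Qed.

End one_triple.

(** P is absolutely continuous with respect to W on the events up to time t, so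
    what W neglects there P neglects as well, for any other potential q. *)
Lemma penalised_lty (q phi q' phi' : plane R -> R) P (t : R) :
  classI q -> phi_properties W q phi -> penalised_triple q' phi' P -> (0 <= t)%R ->
  {ae P, forall w, additive_functional q t w < +oo}.
Proof.
move=> qI phiP [q'I phi'P PL _] t0.
pose N : set (path R) := [set w | additive_functional q t w = +oo].
have FN : filt t N.
  have := measurable_Filt_additive_functional q phi phiP t t0.
  move=> /(_ measurableT [set +oo] (emeasurable_set1 _)).
  by rewrite setTI.
have mN : measurable (N : set (Omega R)) by exact: filt_measurable FN.
have mM : measurable_fun [set: Omega R] (penalisation_density q' phi' (0%R, 0%R) t).
  by apply: (measurable_Filt_Omega t) => //; exact: measurable_Filt_density.
have WN : W (0%R, 0%R) N = 0.
  apply: measure_negligible => //; apply: negligibleS (additive_functional_lty W brownian_W q phi t qI phiP t0).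
  by move=> w /= ->; rewrite ltxx.
exists N; split => //.
  by rewrite (PL t)//; apply: null_set_integral => //; exact: measurable_funTS.
by move=> w /=; rewrite ltey => /negP; rewrite negbK => /eqP.
Qed.

(** A transient path leaves the support of q for good, after which the functional no
    longer increases. *)
Lemma penalised_infty_lty (q phi q' phi' : plane R -> R) P :
  classI q -> phi_properties W q phi -> penalised_triple q' phi' P ->
  {ae P, forall w, additive_functional_infty q w < +oo}.
Proof.
move=> qI phiP tP.
have [mq q0 cq _ _] := qI.
have [r qr] := compactly_supported_bound _ q cq.
have h1 : {ae P, forall w, forall n, additive_functional q n%:R w < +oo}.
  by apply: ae_all => n; exact: (penalised_lty _ _ _ _ _ _ qI phiP tP).
have [_ _ _ trP] := tP.
have h2 := ae_and _ _ _ _ _ _ h1 trP.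
apply: ae_impl h2 => w [wfin /cvgryPgt /(_ r) [T [_ wT]]].
pose N := (Num.truncn `|T|).+1.
have TN : (T < N%:R)%R by rewrite (le_lt_trans (ler_norm T))// truncnS_gt.
apply: le_lt_trans (wfin N).
rewrite additive_functional_inftyE//; apply: ge_ereal_sup => _ [t _ <-].
have [tN|Nt] := leP t N%:R; first exact: additive_functional_nd.
have mw := measurable_along_path q mq w.
rewrite /additive_functional (@itv_bndbnd_setU _ _ _ (BRight N%:R)) ?bnd_simp ?(ltW Nt)//.
rewrite ge0_integral_setU//=; last 3 first.
- exact: measurable_funTS.
- by move=> s _; rewrite lee_fin.
- rewrite disj_set2E; apply/eqP/seteqP; split => // u [/=]; rewrite !in_itv/=.
  by move=> /andP[_ u1] /andP[u2 _]; have := lt_le_trans u2 u1; rewrite ltxx.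
rewrite [X in _ + X](_ : _ = 0) ?adde0//.
apply: integral0_eq => s /=; rewrite in_itv/= => /andP[Ns _].
by rewrite qr//; apply: wT; exact: lt_trans Ns.
Qed.

End penalised.

(** * Comparison of two penalisations *)

Section identity.
Context {R : realType} (W : plane R -> probability (Omega R) R).
Hypothesis brownian_W : forall z : plane R, brownian_law z (W z).
Local Open Scope ereal_scope.

Section one_triple.
Variables (q phi : plane R -> R) (P : probability (Omega R) R).
Hypothesis tP : penalised_triple W q phi P.

Let qI : classI q. Proof. by case: tP. Qed.
Let phiP : phi_properties W q phi. Proof. by case: tP. Qed.
Let mq : measurable_fun setT q. Proof. by case: qI. Qed.
Let q0 z : (0 <= q z)%R. Proof. by case: qI. Qed.
Let phi_gt0 z : (0 < phi z)%R. Proof. by case: phiP. Qed.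
Let cphi : continuous phi. Proof. by case: phiP. Qed.
Let mphi : measurable_fun setT phi. Proof. exact: continuous_plane_measurable. Qed.
Let phi_log : log_asymptotic phi. Proof. by case: phiP. Qed.

(** P at time t has density phi(X_t) times the discount, up to the constant phi 0. *)
Lemma penalised_to_brownian t (f : path R -> \bar R) :
  (0 <= t)%R -> measurable_fun [set: Filt R t] f -> (forall w, 0 <= f w) ->
  (phi 0%R)%:E * \int[P]_w f w =
  \int[W 0%R]_w (f w * ((phi (coord t w))%:E * discount q t w)).
Proof.
move=> t0 mf f0.
have [_ _ PL _] := tP.
have mM := measurable_Filt_density _ _ _ phiP _ t0.
have M0 w := penalisation_density_ge0 _ _ _ phiP t w.
rewrite (change_of_measure (W 0%R) P t _ t0 mM M0 _ _ f)//; last 2 first.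
- by move=> w; exact: penalisation_density_fin_num.
- by move=> A At; exact: PL.
rewrite -ge0_integralZl//; last 3 first.
- by apply: emeasurable_funM; [exact: (measurable_Filt_Omega t t0 _ mf)|exact: (measurable_Filt_Omega t t0 _ mM)].
- by move=> w _; rewrite mule_ge0.
- by rewrite lee_fin ltW.
apply: eq_integral => w _; rewrite penalisation_densityE muleCA; congr (_ * _).
by rewrite muleA -EFinM mulrC divfK ?gt_eqF.
Qed.

Variables (q' phi' : plane R -> R).
Hypotheses (q'I : classI q') (phi'P : phi_properties W q' phi').
Variable psi : plane R -> R.
Hypotheses (psi_gt0 : forall z, (0 < psi z)%R) (cpsi : continuous psi).
Hypothesis psi_log : log_asymptotic psi.
Variables (s : R) (G : set (path R)).
Hypotheses (s0 : (0 <= s)%R) (sG : filt s G).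

Let mq' : measurable_fun setT q'. Proof. by case: q'I. Qed.
Let q'0 z : (0 <= q' z)%R. Proof. by case: q'I. Qed.

(** The quotient psi / phi at X_t trades the density of P for an expression where
    q and q' play symmetric roles; it tends to 1 along transient paths. *)
Let F t (w : path R) := (\1_G w * (psi (coord t w) / phi (coord t w)))%:E * discount q' t w.

Let F0 t w : 0 <= F t w.
Proof. by rewrite mule_ge0 ?expeR_ge0// lee_fin mulr_ge0// divr_ge0// ltW. Qed.

Let mF t : (s <= t)%R -> measurable_fun [set: Filt R t] (F t).
Proof.
move=> st; have t0 : (0 <= t)%R by exact: le_trans st.
have -> : F t = fun w => (\1_G w)%:E * (psi (coord t w) / phi (coord t w))%:E * discount q' t w.
  by apply/funext => w; rewrite /F EFinM.
apply: emeasurable_funM; last exact: (measurable_Filt_discount W q' phi').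
apply: emeasurable_funM.
  apply/measurable_EFinP; apply: measurable_indic.
  exact: filt_mono sG.
apply: (measurable_Filt_coord t (fun z => psi z / phi z)%R) => //.
apply: continuous_plane_measurable => z.
by apply: cvgM; [exact: cpsi|apply: cvgV; [rewrite gt_eqF|exact: cphi]].
Qed.

Lemma level_identity t : (s <= t)%R ->
  (phi 0%R)%:E * \int[P]_w F t w =
  \int[W 0%R]_w ((\1_G w * psi (coord t w))%:E * (discount q t w * discount q' t w)).
Proof.
move=> st; have t0 : (0 <= t)%R by exact: le_trans st.
rewrite (penalised_to_brownian t)//; last exact: mF.
apply: eq_integral => w _; rewrite /F muleACA -EFinM [discount q' t w * _]muleC.
by rewrite -mulrA divfK ?gt_eqF.
Qed.

Let discount'_cvg w : discount q' n%:R w @[n --> \oo] --> discount_infty q' w.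
Proof.
apply: discount_cvg; first exact: additive_functional_infty_ge0.
exact: additive_functional_cvg.
Qed.

Lemma discount_infty_fin_num w : discount_infty q' w \is a fin_num.
Proof.
rewrite ge0_fin_numE ?expeR_ge0// (@le_lt_trans _ _ 1) ?ltry//.
rewrite -expeR0 lee_expeR oppe_le0 mule_ge0 ?lee_fin//.
exact: additive_functional_infty_ge0.
Qed.

Lemma measurable_discount_infty : measurable_fun [set: Omega R] (discount_infty q').
Proof.
apply: (measurableT_comp (@measurable_expeR R)); apply: (measurableT_comp (@oppe_measurable R setT)).
by apply: measurable_funeM; exact: measurable_additive_functional_infty.
Qed.

Lemma ratio_along_path w : cmod (coord t w) @[t --> +oo%R] --> +oo%R ->
  (psi (coord n%:R w) / phi (coord n%:R w))%R @[n --> \oo] --> (1 : R)%R.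
Proof.
move=> /cvgryPgt wt.
apply: (@cvg_comp _ _ _ (fun n : nat => coord n%:R w) (fun z => psi z / phi z)%R _ cinfty).
  by move=> A [r _ rA]; have [M _ HM] := @cvgr_idn R _ (wt r); exists M => // n Mn; apply: rA; exact: (HM n Mn).
exact: log_asymptotic_ratio.
Qed.

(** Dominated convergence: the quotient is bounded on the plane and tends to 1 along
    transient paths. *)
Lemma level_limit :
  \int[P]_w F n%:R w @[n --> \oo] --> \int[P]_w ((\1_G w)%:E * discount_infty q' w).
Proof.
have [K KP] := log_asymptotic_ratio_bounded phi psi phi_gt0 cphi cpsi phi_log psi_log.
have [_ _ _ trP] := tP.
(* From the index N on, the event G is known. *)
pose N := (Num.truncn s).+1.
have sN n : (s <= (n + N)%:R)%R.
  by rewrite (le_trans (ltW (truncnS_gt s)))// ler_nat leq_addl.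
have mG : measurable (G : set (Omega R)) by exact: filt_measurable sG.
rewrite -(cvg_shiftn N).
have := @dominated_convergence _ _ R P setT measurableT (fun n => F (n + N)%:R)
  (fun w => (\1_G w)%:E * discount_infty q' w) (cst K%:E).
case=> //.
- move=> n; apply: (measurable_Filt_Omega (n + N)%:R) => //; exact: mF.
- apply: emeasurable_funM; last exact: measurable_discount_infty.
  by apply/measurable_EFinP; exact: measurable_indic.
- apply: ae_impl trP => w wt _.
  rewrite (cvg_shiftn N (fun n => F n%:R w)).
  have hd : (\1_G w)%:E *? discount_infty q' w.
    by apply: mule_def_fin => //; exact: discount_infty_fin_num.
  apply: (cvgeM hd _ (discount'_cvg w)).
  apply: cvg_EFin; first exact: nearW.
  rewrite -[X in _ --> X]mulr1.
  by apply: cvgM; [exact: cvg_cst|exact: ratio_along_path].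
- by apply: finite_measure_integrable_cst.
- apply: aeW => w n _; rewrite gee0_abs//.
  rewrite /F -[leRHS]mule1; apply: lee_pmul => //.
  + by rewrite lee_fin mulr_ge0// divr_ge0// ltW.
  + exact: discount_ge0.
  + rewrite lee_fin indicE; case: (_ \in _); rewrite ?mul1r// mul0r.
    by rewrite (le_trans _ (KP 0%R))// divr_ge0// ltW.
  + exact: discount_le1.
Qed.

End one_triple.
End identity.

Section independence_of_q.
Context {R : realType} (W : plane R -> probability (Omega R) R).
Hypothesis brownian_W : forall z : plane R, brownian_law z (W z).
Local Open Scope ereal_scope.

Definition weight (q phi : plane R -> R) (w : path R) :=
  (phi (0%R, 0%R))%:E * expeR (2^-1%:E * additive_functional_infty q w).

Lemma weight_ge0 q phi w : (forall z, (0 < phi z)%R) -> 0 <= weight q phi w.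
Proof. by move=> phi0; rewrite mule_ge0 ?expeR_ge0// lee_fin ltW. Qed.

Lemma measurable_weight q phi : classI q ->
  measurable_fun [set: Omega R] (weight q phi).
Proof.
move=> [mq q0 _ _ _]; apply: measurable_funeM.
apply: (measurableT_comp (@measurable_expeR R)).
by apply: measurable_funeM; exact: measurable_additive_functional_infty.
Qed.

Lemma discount_infty_le1 (q : plane R -> R) w : classI q -> discount_infty q w <= 1.
Proof.
move=> [mq q0 _ _ _]; rewrite -expeR0 lee_expeR oppe_le0 mule_ge0 ?lee_fin//.
exact: additive_functional_infty_ge0.
Qed.

(** Multiplying and dividing by the discount of q', which is positive for
    almost every path, expresses the weighted law through a finite measure. *)
Lemma discount_weight q phi q' phi' P (A : set (Omega R)) :
  penalised_triple W q phi P -> classI q' -> phi_properties W q' phi' -> measurable A ->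
  \int[P]_(w in A) weight q phi w =
  \int[P]_w ((\1_A w)%:E * expeR (2^-1%:E * additive_functional_infty q w +
                                  2^-1%:E * additive_functional_infty q' w) *
     ((phi (0%R, 0%R))%:E * discount_infty q' w)).
Proof.
move=> tP q'I phi'P mA.
have [qI [phi_gt0 _ _ _ _] _ _] := tP.
have mw := measurable_weight q phi qI.
have w0 w := weight_ge0 q phi w phi_gt0.
have [mq q0 _ _ _] := qI; have [mq' q'0 _ _ _] := q'I.
rewrite integral_mkcond; apply: ge0_ae_eq_integral => //.
- exact/(measurable_restrictT _ _).1/measurable_funTS.
- apply: emeasurable_funM; last first.
    by apply: measurable_funeM; exact: measurable_discount_infty.
  apply: emeasurable_funM; first by apply/measurable_EFinP; exact: measurable_indic.
  apply: (measurableT_comp (@measurable_expeR R)); apply: emeasurable_funD;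
    by apply: measurable_funeM; exact: measurable_additive_functional_infty.
- by move=> w _; apply: erestrict_ge0.
- by move=> w _; rewrite !mule_ge0 ?expeR_ge0 ?lee_fin// ltW.
apply: ae_impl (penalised_infty_lty W brownian_W q' phi' q phi P q'I phi'P tP) => w wfin _.
have Bfin : 2^-1%:E * additive_functional_infty q' w \is a fin_num.
  by rewrite fin_numM// ge0_fin_numE//; exact: additive_functional_infty_ge0.
rewrite patchE indicE; case: ifPn => _; last by rewrite !mul0e.
rewrite mul1e /weight /discount_infty muleCA; congr (_ * _).
by rewrite -expeRD addeK.
Qed.

Section two_triples.
Variables (q1 phi1 q2 phi2 : plane R -> R) (P1 P2 : probability (Omega R) R).
Hypotheses (t1 : penalised_triple W q1 phi1 P1) (t2 : penalised_triple W q2 phi2 P2).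

(** At each time t both sides are the Brownian expectation of phi2(X_t) times the two
    discounts. *)
Lemma discounted_identity s G : (0 <= s)%R -> filt s G ->
  (phi1 (0%R, 0%R))%:E * \int[P1]_w ((\1_G w)%:E * discount_infty q2 w) =
  (phi2 (0%R, 0%R))%:E * \int[P2]_w ((\1_G w)%:E * discount_infty q1 w).
Proof.
move=> s0 sG.
have [q1I phi1P _ _] := t1; have [q2I phi2P _ _] := t2.
have [phi1_gt0 c1 log1 _ _] := phi1P; have [phi2_gt0 c2 log2 _ _] := phi2P.
have l1 := level_limit W q1 phi1 P1 t1 q2 phi2 q2I phi2P phi2 phi2_gt0 c2 log2 s G s0 sG.
have l2 := level_limit W q2 phi2 P2 t2 q1 phi1 q1I phi1P phi2 phi2_gt0 c2 log2 s G s0 sG.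
have {}l1 := cvgeZl (isT : (phi1 (0%R, 0%R))%:E \is a fin_num) l1.
have {}l2 := cvgeZl (isT : (phi2 (0%R, 0%R))%:E \is a fin_num) l2.
suff l12 : (phi1 (0%R, 0%R))%:E * \int[P1]_w ((\1_G w * (phi2 (coord n%:R w) / phi1 (coord n%:R w)))%:E *
      discount q2 n%:R w) @[n --> \oo] -->
    (phi2 (0%R, 0%R))%:E * \int[P2]_w ((\1_G w)%:E * discount_infty q1 w).
  exact: (cvg_unique _ l1 l12).
apply: cvg_trans l2; apply: near_eq_cvg; near=> n.
have sn : (s <= n%:R)%R by near: n; exact: nbhs_infty_ger.
rewrite (level_identity W q1 phi1 P1 t1 q2 phi2 phi2P phi2 phi2_gt0 c2 s G s0 sG _ sn).
rewrite (level_identity W q2 phi2 P2 t2 q1 phi1 phi1P phi2 phi2_gt0 c2 s G s0 sG _ sn).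
by apply: eq_integral => w _; rewrite [X in _ * X]muleC.
Unshelve. all: by end_near. Qed.

(** Both discounted laws are finite and agree on the events known at some finite
    time, hence everywhere; integrating the common density that undoes the two
    discounts gives the weighted laws. *)
Lemma weight_identity (A : set (Omega R)) : measurable A ->
  \int[P1]_(w in A) weight q1 phi1 w = \int[P2]_(w in A) weight q2 phi2 w.
Proof.
move=> mA.
have [q1I phi1P _ _] := t1; have [q2I phi2P _ _] := t2.
have [phi1_gt0 _ _ _ _] := phi1P; have [phi2_gt0 _ _ _ _] := phi2P.
have mg (a : R) q : classI q ->
    measurable_fun [set: Omega R] (fun w => a%:E * discount_infty q w).
  by move=> qI; apply: measurable_funeM; exact: measurable_discount_infty.
have g0 (a : R) q w : (0 < a)%R -> 0 <= a%:E * discount_infty q w.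
  by move=> a0; rewrite mule_ge0 ?expeR_ge0// lee_fin ltW.
pose m1 := density_measure P1 (mg (phi1 (0%R, 0%R)) q2 q2I) (fun w => g0 _ q2 w (phi1_gt0 _)).
pose m2 := density_measure P2 (mg (phi2 (0%R, 0%R)) q1 q1I) (fun w => g0 _ q1 w (phi2_gt0 _)).
have mE (P : probability (Omega R) R) (a : R) q (B : set (Omega R)) : (0 < a)%R -> classI q -> measurable B ->
    \int[P]_(w in B) (a%:E * discount_infty q w) =
    a%:E * \int[P]_w ((\1_B w)%:E * discount_infty q w).
  move=> a0 qI mB; rewrite -ge0_integralZl//; last 3 first.
  - apply: emeasurable_funM; last exact: measurable_discount_infty.
    by apply/measurable_EFinP; exact: measurable_indic.
  - by move=> w _; rewrite mule_ge0 ?expeR_ge0 ?lee_fin.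
  - by rewrite lee_fin ltW.
  rewrite [LHS]integral_mkcond; apply: eq_integral => w _.
  by rewrite patchE indicE; case: ifPn => _; rewrite ?mul1e// mul0e mule0.
have m12 (B : set (Omega R)) : measurable B -> m1 B = m2 B.
  apply: (@measure_unique _ R (Omega R) (\bigcup_(t in halfline R) filt t) (fun=> setT) erefl _ _ _ m1 m2) => //.
  - move=> X Y [s s0 sX] [t t0 tY]; exists (Num.max s t).
      by rewrite /halfline/= le_max s0.
    have hX : (measurable (X : set (Filt R (Num.max s t)))).
      by apply: filt_mono sX; rewrite le_max lexx.
    have hY : (measurable (Y : set (Filt R (Num.max s t)))).
      by apply: filt_mono tY; rewrite le_max lexx orbT.
    exact: (@measurableI _ (Filt R (Num.max s t)) X Y hX hY).
  - by move=> _; exists 0%R; [rewrite /halfline/= lexx|exact: filtT].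
  - by rewrite bigcup_const.
  - move=> X [s s0 sX].
    have mX : measurable (X : set (Omega R)) by exact: filt_measurable sX.
    transitivity (\int[P1]_(w in X) ((phi1 (0%R, 0%R))%:E * discount_infty q2 w)) => //.
    transitivity (\int[P2]_(w in X) ((phi2 (0%R, 0%R))%:E * discount_infty q1 w)) => //.
    by rewrite (mE P1 _ q2 X)// (mE P2 _ q1 X)//; exact: discounted_identity sX.
  - move=> _; apply: (@le_lt_trans _ _ (\int[P1]_(w in setT) (phi1 (0%R, 0%R))%:E)).
      apply: ge0_le_integral => //; first by move=> w _; exact: (g0 _ q2 w (phi1_gt0 _)).
        exact: (mg _ _ q2I).
      move=> w _; rewrite -[leRHS]mule1; apply: lee_wpmul2l.
        by rewrite lee_fin ltW.
      exact: (discount_infty_le1 q2 w q2I).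
    by rewrite integral_cst// [X in _ * X](@probability_setT _ _ _ P1) mule1 ltry.
have gfin (a : R) q w : classI q -> a%:E * discount_infty q w \is a fin_num.
  by move=> qI; rewrite fin_numM// discount_infty_fin_num.
have mf q q' : classI q -> classI q' -> measurable_fun [set: Omega R]
    (fun w => (\1_A w)%:E * expeR (2^-1%:E * additive_functional_infty q w +
                                  2^-1%:E * additive_functional_infty q' w)).
  move=> [mq q0 _ _ _] [mq' q'0 _ _ _].
  apply: emeasurable_funM; first by apply/measurable_EFinP; exact: measurable_indic.
  apply: (measurableT_comp (@measurable_expeR R)); apply: emeasurable_funD;
    by apply: measurable_funeM; exact: measurable_additive_functional_infty.
have f0 q q' w : 0 <= (\1_A w)%:E * expeR (2^-1%:E * additive_functional_infty q w +
                                  2^-1%:E * additive_functional_infty q' w).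
  by rewrite mule_ge0 ?expeR_ge0 ?lee_fin.
rewrite (discount_weight _ _ _ _ _ _ t1 q2I phi2P)// (discount_weight _ _ _ _ _ _ t2 q1I phi1P)//.
rewrite -(@integral_density _ _ R P1 m1 _ (mg _ _ q2I) (fun w => g0 _ q2 w (phi1_gt0 _))
  (fun w => gfin _ _ w q2I) (fun B mB => erefl) _ (mf _ _ q1I q2I) (f0 q1 q2)).
rewrite -(@integral_density _ _ R P2 m2 _ (mg _ _ q1I) (fun w => g0 _ q1 w (phi2_gt0 _))
  (fun w => gfin _ _ w q1I) (fun B mB => erefl) _ (mf _ _ q2I q1I) (f0 q2 q1)).
under [RHS]eq_integral do rewrite addeC.
by apply: eq_measure_integral => B mB _; exact: m12.
Qed.

End two_triples.
End independence_of_q.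

(** * Total mass and sigma-finiteness *)

Section total_mass.
Context {R : realType} (W : plane R -> probability (Omega R) R).
Hypothesis brownian_W : forall z : plane R, brownian_law z (W z).
Local Open Scope ereal_scope.

(** phi is at least 2 K outside a large disc, which the process at a late time
    occupies with probability at most one half. *)
Lemma expectation_large (phi : plane R -> R) (K : R) : (0 <= K)%R ->
  (forall z, (0 <= phi z)%R) -> continuous phi -> log_asymptotic phi ->
  exists2 t, (0 <= t)%R & K%:E <= \int[W 0%R]_w (phi (coord t w))%:E.
Proof.
move=> K0 phi0 cphi phi_log.
have [r rphi] := log_asymptotic_large phi (2 * K) phi_log.
pose s := Num.max 1%R r.
have s0 : (0 < s)%R by rewrite lt_max ltr01.
(* At this time the normal peak is at most 1 / (4 s). *)
pose t := (16 * s ^+ 2)%R.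
have t0 : (0 < t)%R by rewrite mulr_gt0// exprn_gt0.
exists t; first exact: ltW.
pose C : set (Omega R) := (fun w : Omega R => (coord t w).1) @^-1` `[(- s)%R, s]%classic.
have mC : measurable C.
  rewrite -[X in measurable X]setTI.
  by apply: (measurableT_comp measurable_fst (measurable_coord t)) => //; exact: measurable_itv.
have WC : W 0%R C <= (2^-1)%:E.
  apply: le_trans (small_strip W brownian_W t s t0 (ltW s0)) _; rewrite lee_fin.
  rewrite /normal_peak sqr_sqrtr ?(ltW t0)//.
  have S4 : (4 * s <= Num.sqrt (t * pi *+ 2))%R.
    have s4 : (0 <= 4 * s)%R by lra.
    rewrite -(ger0_norm s4) -sqrtr_sqr ler_wsqrtr//.
    rewrite -[leRHS]mulr_natr exprMn.
    rewrite (_ : (4 ^+ 2 * s ^+ 2)%R = t); last by rewrite /t; ring.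
    by have := pi_ge2 R; nra.
  have S0 : (0 < Num.sqrt (t * pi *+ 2))%R by lra.
  by rewrite mulrC ler_pdivrMr//; lra.
apply: (@le_trans _ _ (\int[W 0%R]_(w in ~` C) (2 * K)%:E)).
  rewrite integral_cst; last exact: measurableC.
  rewrite [X in _ * X](_ : _ = 1 - W 0%R C); last exact: probability_setC.
  rewrite (_ : K%:E = (2 * K)%:E * (2^-1)%:E); last by rewrite -EFinM; congr EFin; field.
  apply: lee_wpmul2l; first by rewrite lee_fin mulr_ge0.
  rewrite leeBrDr ?fin_num_measure//.
  apply: (@le_trans _ _ ((2^-1)%:E + (2^-1)%:E)); first exact: leeD2l.
  by rewrite -EFinD lee_fin; lra.
apply: (@le_trans _ _ (\int[W 0%R]_(w in ~` C) (phi (coord t w))%:E)).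
  apply: ge0_le_integral => //.
  - exact: measurableC.
  - by move=> w _; rewrite lee_fin mulr_ge0.
  - by apply: measurable_funTS; apply: measurable_at; exact: continuous_plane_measurable.
  - move=> w Cw; rewrite lee_fin; apply: rphi.
    apply: (@le_lt_trans _ _ s); first by rewrite le_max lexx orbT.
    have sx : (s < `|(coord t w).1|)%R.
      rewrite ltNge; apply/negP => xs; apply: Cw.
      by rewrite /C/= in_itv/= -ler_norml.
    by apply: lt_le_trans sx _; rewrite -sqrtr_sqr /cmod ler_wsqrtr// lerDl sqr_ge0.
apply: (@ge0_subset_integral _ (Omega R) R (W 0%R) (~` C) setT (measurableC mC) measurableT) => //.
- by apply: measurable_at; exact: continuous_plane_measurable.
- by move=> w _; rewrite lee_fin.
Qed.

Section one_triple.
Variables (q phi : plane R -> R) (P : probability (Omega R) R).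
Hypothesis tP : penalised_triple W q phi P.

Let qI : classI q. Proof. by case: tP. Qed.
Let phiP : phi_properties W q phi. Proof. by case: tP. Qed.
Let mq : measurable_fun setT q. Proof. by case: qI. Qed.
Let q0 z : (0 <= q z)%R. Proof. by case: qI. Qed.
Let phi_gt0 z : (0 < phi z)%R. Proof. by case: phiP. Qed.

(** The weight up to time t compensates the discount exactly, as the functional is
    finite almost surely. *)
Lemma weight_mass_ge t : (0 <= t)%R ->
  \int[W 0%R]_w (phi (coord t w))%:E <= \int[P]_w weight q phi w.
Proof.
move=> t0.
have mphi : measurable_fun setT phi.
  by apply: continuous_plane_measurable; case: phiP.
pose f (w : path R) := expeR (2^-1%:E * additive_functional q t w).
have f0 w : 0 <= f w by exact: expeR_ge0.
have mf : measurable_fun [set: Filt R t] f.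
  apply: (measurableT_comp (@measurable_expeR R)); apply: measurable_funeM.
  exact: (measurable_Filt_additive_functional W q phi phiP t t0).
have mfO : measurable_fun [set: Omega R] f := measurable_Filt_Omega t t0 _ mf.
have -> : \int[W 0%R]_w (phi (coord t w))%:E =
    \int[W 0%R]_w (f w * ((phi (coord t w))%:E * discount q t w)).
  apply: ge0_ae_eq_integral => //.
  - exact: measurable_at.
  - apply: emeasurable_funM => //; apply: emeasurable_funM; first exact: measurable_at.
    exact: measurable_discount.
  - by move=> w _; rewrite lee_fin ltW.
  - by move=> w _; rewrite !mule_ge0 ?expeR_ge0 ?lee_fin ?ltW.
  - apply: ae_impl (additive_functional_lty W brownian_W q phi t qI phiP t0) => w wfin _.
    have Afin : 2^-1%:E * additive_functional q t w \is a fin_num.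
      by rewrite fin_numM// ge0_fin_numE//; exact: additive_functional_ge0.
    by rewrite muleCA /f /discount -expeRD subee// expeR0 mule1.
rewrite -(penalised_to_brownian W q phi P tP)// -ge0_integralZl//; last first.
  by rewrite lee_fin ltW.
apply: ge0_le_integral => //.
- by move=> w _; rewrite mule_ge0// lee_fin ltW.
- exact: measurable_funeM.
- exact: measurable_weight.
- move=> w _; apply: lee_wpmul2l; first by rewrite lee_fin ltW.
  rewrite lee_expeR; apply: lee_wpmul2l; first by rewrite lee_fin invr_ge0.
  exact: additive_functional_le_infty.
Qed.

Lemma weight_mass_infinite : \int[P]_w weight q phi w = +oo.
Proof.
have [_ cphi phi_log _ _] := phiP.
have mass K : (0 <= K)%R -> K%:E <= \int[P]_w weight q phi w.
  move=> K0; have [t t0 Kt] := expectation_large phi K K0 (fun z => ltW (phi_gt0 z)) cphi phi_log.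
  exact: le_trans Kt (weight_mass_ge t t0).
case: (\int[P]_w _) mass => [a|//|] mass.
- have := mass (`|a| + 1)%R; rewrite lee_fin => /(_ (addr_ge0 (normr_ge0 _) ler01)).
  by rewrite leNgt (le_lt_trans (ler_norm a))// ltrDl ltr01.
- by have := mass 0%R (lexx _).
Qed.

Let weight_measure := density_measure P (measurable_weight q phi qI)
  (fun w => weight_ge0 q phi w phi_gt0).

(** The sublevel sets of the functional have finite weighted mass; the paths of
    infinite functional form a null set that is added to each of them. *)
Lemma weight_sigma_finite : sigma_finite [set: Omega R] weight_measure.
Proof.
pose A_ := additive_functional_infty q.
have mA : measurable_fun [set: Omega R] A_ by exact: measurable_additive_functional_infty.
pose N : set (Omega R) := [set w | A_ w = +oo].
have mN : measurable N.
  by rewrite -[N]setTI; exact: (mA measurableT _ (emeasurable_set1 _)).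
have mF n : measurable ([set w | A_ w <= n%:R%:E] `|` N : set (Omega R)).
  apply: measurableU => //; rewrite -[X in measurable X]setTI.
  exact: emeasurable_fun_infty_c.
exists (fun n => [set w | A_ w <= n%:R%:E] `|` N).
  apply/esym/seteqP; split=> // w _ /=.
  have : 0 <= A_ w by exact: additive_functional_infty_ge0.
  case E : (A_ w) => [a||]// _; last by exists 0%N => //; right.
  exists (Num.truncn a).+1 => //; left.
  by rewrite /= E lee_fin ltW// truncnS_gt.
move=> n; split => //.
pose B := (phi (0%R, 0%R))%:E * expeR (2^-1%:E * n%:R%:E).
apply: (@le_lt_trans _ _ (\int[P]_(w in [set w | A_ w <= n%:R%:E] `|` N) B)).
  apply: ae_ge0_le_integral => //.
  - by move=> w _; exact: weight_ge0.
  - by apply: measurable_funTS; exact: measurable_weight.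
  - by move=> w _; rewrite mule_ge0 ?expeR_ge0// lee_fin ltW.
  - apply: ae_impl (penalised_infty_lty W brownian_W q phi q phi P qI phiP tP) => w wfin.
    case=> /= [wn|wN]; last by move: wfin; rewrite -/A_ wN ltxx.
    apply: lee_wpmul2l; first by rewrite lee_fin ltW.
    by rewrite lee_expeR; apply: lee_wpmul2l; first by rewrite lee_fin invr_ge0.
rewrite integral_cst//; apply: lte_mul_pinfty => //.
- by rewrite lee_fin mulr_ge0 ?expR_ge0// ltW.
- by rewrite ltey_eq fin_num_measure.
Qed.

End one_triple.
End total_mass.

(** When no admissible data exist the identity is vacuous, and any infinite
    sigma-finite measure will do; the paths standing still at the points n serve to
    build one. *)
Definition constant_path (R : realType) (n : nat) : Omega R :=
  (cst (n%:R, 0) : continuousType (set_type (halfline R)) (plane R)).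

Lemma sigma_finite_infinite_measure (R : realType) :
  exists m : {measure set (Omega R) -> \bar R},
    sigma_finite [set: Omega R] m /\ m [set: Omega R] = +oo%E.
Proof.
have mc : measurable_fun setT (@constant_path R) by [].
pose m := pushforward (@counting nat R) (@constant_path R).
unshelve eexists (m : {measure set (Omega R) -> \bar R}); first exact: mc.
split; last first.
  rewrite /m/= /pushforward preimage_setT /counting; case: ifPn => //.
  by rewrite asboolE => /infinite_nat.
pose F n : set (Omega R) := coord 0 @^-1` [set z | z.1 <= n%:R].
exists F.
  apply/esym/seteqP; split=> // w _.
  by exists (Num.truncn `|(coord 0 w).1|).+1 => //=; rewrite /F/= (le_trans (ler_norm _))// ltW// truncnS_gt.
move=> n; split.
  have mfst : measurable ([set z | z.1 <= n%:R] : set (plane R)).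
    rewrite (_ : [set z | _] = fst @^-1` `]-oo, n%:R]%classic); last first.
      by apply/seteqP; split=> z; rewrite /= in_itv.
    by rewrite -[X in measurable X]setTI; apply: measurable_fst => //; exact: measurable_itv.
  by rewrite -[X in measurable X]setTI; exact: (measurable_coord 0 measurableT _ mfst).
rewrite /m/= /pushforward /counting ifT ?ltry//; apply/asboolP.
apply: (@sub_finite_set _ _ `I_n.+1); last exact: finite_II.
by move=> k; rewrite /F/= /coord/= ler_nat ltnS.
Qed.

Theorem theorem2p1p2 (R : realType)
    (W : plane R -> probability (Omega R) R)
    (brownian_W : forall z : plane R, brownian_law z (W z)) :
  exists bW : {measure set (Omega R) -> \bar R},
    [/\ sigma_finite [set: Omega R] bW,
        bW [set: Omega R] = +oo%E &
        forall q : plane R -> R, classI q ->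
        forall phi : plane R -> R, phi_solution q phi -> phi_properties W q phi ->
        forall P : probability (Omega R) R,
          penalised_law (W (0, 0)) q phi (0, 0) P -> transient P ->
        forall A : set (Omega R), measurable A ->
          bW A = (\int[P]_(w in A)
            ((phi (0%R, 0%R))%:E *
             expeR (2^-1%:E * additive_functional_infty q w)))%E].
Proof.
(* One admissible triple defines the measure; the others give the same one. *)
have [[q [phi [P tP]]]|noT] := pselect (exists q phi P, penalised_triple W q phi P).
  have [qI [phi_gt0 _ _ _ _] _ _] := tP.
  exists (density_measure P (measurable_weight q phi qI)
    (fun w => weight_ge0 q phi w phi_gt0)); split.
  - exact: (weight_sigma_finite W brownian_W q phi P tP).
  - exact: (weight_mass_infinite W brownian_W q phi P tP).
  - move=> q' q'I phi' _ phi'P P' P'law P'trans A mA.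
    exact: (weight_identity W brownian_W q phi q' phi' P P' tP).
have [m [mfin minf]] := sigma_finite_infinite_measure R.
exists m; split => // q qI phi _ phiP P Plaw Ptrans.
by exfalso; apply: noT; exists q, phi, P.
Qed.
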